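(* Let $q$ be an odd prime power, $n\ge 3$ an odd integer, $\varepsilon\in\{1,-1\}$, and let $\mathcal Q=\mathcal Q^\varepsilon(n,q)$ be the non-degenerate hyperbolic ($\varepsilon=1$) or elliptic ($\varepsilon=-1$) quadric in $\mathrm{PG}(n,q)$. Let $\mathcal P$ be the set of anisotropic points of $\mathcal Q$, and let $R_0,\dots,R_5$ be the relations on $\mathcal P$ defined in the context. Then $R_0,\dots,R_5$ constitute an association scheme on $\mathcal P$. With $m=\frac{n-1}{2}$, for a suitable ordering $V_0,\dots,V_5$ of its eigenspaces, its matrix of eigenvalues $\mathbf P$ (rows indexed by $V_0,\dots,V_5$, columns by $R_0,\dots,R_5$) is $$\mathbf P=\begin{pmatrix} 1 & q^{n-1}-1 & \frac14 q^{m}(q^{m}+\varepsilon)(q-3) & \frac14 q^{m}(q^{m}-\varepsilon)(q-1) & \frac14 q^{m}(q^{m}+\varepsilon)(q-1) & \frac14 q^{m}(q^{m}-\varepsilon)(q+1)\\ 1 & q^{n-1}-1 & \frac14 q^{m}(q^{m}+\varepsilon)(q-3) & \frac14 q^{m}(q^{m}-\varepsilon)(q-1) & -\frac14 q^{m}(q^{m}+\varepsilon)(q-1) & -\frac14 q^{m}(q^{m}-\varepsilon)(q+1)\\ 1 & \varepsilon q^{m-1}-1 & \frac14\varepsilon q^{m-1}(q+1)(q-3) & -\frac14\varepsilon q^{m-1}(q-1)^2 & \frac14\varepsilon q^{m-1}(q-1)(q+1) & -\frac14\varepsilon q^{m-1}(q-1)(q+1)\\ 1 & \varepsilon q^{m-1}-1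 & \frac14\varepsilon q^{m-1}(q+1)(q-3) & -\frac14\varepsilon q^{m-1}(q-1)^2 & -\frac14\varepsilon q^{m-1}(q-1)(q+1) & \frac14\varepsilon q^{m-1}(q-1)(q+1)\\ 1 & \varepsilon q^{m}-1 & -\varepsilon q^{m} & 0 & 0 & 0\\ 1 & -\varepsilon q^{m}-1 & 0 & \varepsilon q^{m} & 0 & 0 \end{pmatrix}$$ and its matrix of dual eigenvalues $\mathbf Q$ (rows indexed by $R_0,\dots,R_5$, columns by $V_0,\dots,V_5$) is $$\mathbf Q=\begin{pmatrix} 1 & 1 & q^2\frac{q^{n-1}-1}{q^2-1} & q^2\frac{q^{n-1}-1}{q^2-1} & \frac{q-3}{2(q-1)}(q^{m}+\varepsilon)(q^{m+1}-\varepsilon) & \frac{q-1}{2(q+1)}(q^{m}-\varepsilon)(q^{m+1}-\varepsilon)\\ 1 & 1 & q^2\frac{\varepsilon q^{m-1}-1}{q^2-1} & q^2\frac{\varepsilon q^{m-1}-1}{q^2-1} & \varepsilon\frac{q-3}{2(q-1)}(q^{m+1}-\varepsilon) & -\varepsilon\frac{q-1}{2(q+1)}(q^{m+1}-\varepsilon)\\ 1 & 1 & \varepsilon\frac{q}{q-1}(q^{m}-\varepsilon) & \varepsilon\frac{q}{q-1}(q^{m}-\varepsilon) & -\varepsilon\frac{2}{q-1}(q^{m+1}-\varepsilon) & 0\\ 1 & 1 & -\varepsilon\frac{q}{q+1}(q^{m}+\varepsilon) & -\varepsilon\frac{q}{q+1}(q^{m}+\varepsilon) & 0 & \varepsilon\frac{2}{q+1}(q^{m+1}-\varepsilon)\\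 1 & -1 & \varepsilon\frac{q}{q-1}(q^{m}-\varepsilon) & -\varepsilon\frac{q}{q-1}(q^{m}-\varepsilon) & 0 & 0\\ 1 & -1 & -\varepsilon\frac{q}{q+1}(q^{m}+\varepsilon) & \varepsilon\frac{q}{q+1}(q^{m}+\varepsilon) & 0 & 0 \end{pmatrix}.$$ Here, for $q=3$, the relation $R_2$ is empty and is omitted: $R_0,R_1,R_3,R_4,R_5$ then form a $4$-class association scheme, whose matrices are obtained from $\mathbf P$ and $\mathbf Q$ by deleting the row and column corresponding to $R_2$ and $V_4$.
   Context: Quadric: $\mathcal Q^\varepsilon(n,q)$ ($n$ odd) is the set of points of $\mathrm{PG}(n,q)$ whose coordinate vectors are zeros of $\kappa(x)=x_0x_1+\dots+x_{n-3}x_{n-2}+f(x_{n-1},x_n)$, with $f$ a non-degenerate binary quadratic form that is reducible over $\mathbb F_q$ if $\varepsilon=1$ and irreducible if $\varepsilon=-1$. Points not on $\mathcal Q$ are anisotropic. $S_q$ is the set of non-zero squares of $\mathbb F_q$, $\overline S_q$ the set of non-squares. For an anisotropic point $X$ with coordinate vector $x$, its quadratic type is $\kappa(X)=S_q$ if $\kappa(x)\in S_q$ and $\kappa(X)=\overline S_q$ if $\kappa(x)\in\overline S_q$; products are $S_q\cdot S_q=\overline S_q\cdot\overline S_q=S_q$, $S_q\cdot\overline S_q=\overline S_q\cdot S_q=\overline S_q$. Relations: $R_0$ is the identity relation on $\mathcal P$. For distinct $X,Y\in\mathcal P$, with $\langle X,Y\rangle$ the line joining them: $(X,Y)\in R_1$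 iff $|\langle X,Y\rangle\cap\mathcal Q|=1$ (then automatically $\kappa(X)\cdot\kappa(Y)=S_q$); $(X,Y)\in R_2$ iff $|\langle X,Y\rangle\cap\mathcal Q|=2$ and $\kappa(X)\cdot\kappa(Y)=S_q$; $(X,Y)\in R_3$ iff $|\langle X,Y\rangle\cap\mathcal Q|=0$ and $\kappa(X)\cdot\kappa(Y)=S_q$; $(X,Y)\in R_4$ iff $|\langle X,Y\rangle\cap\mathcal Q|=2$ and $\kappa(X)\cdot\kappa(Y)=\overline S_q$; $(X,Y)\in R_5$ iff $|\langle X,Y\rangle\cap\mathcal Q|=0$ and $\kappa(X)\cdot\kappa(Y)=\overline S_q$. Association scheme: a partition of $\mathcal P\times\mathcal P$ into non-empty symmetric relations $R_0,\dots,R_d$, with $R_0$ the identity, such that for all $i,j,k$ the number $|\{Z:(X,Z)\in R_i,(Y,Z)\in R_j\}|$ is the same for all $(X,Y)\in R_k$. If $A_i$ is the 0/1 adjacency matrix of $R_i$, the real span of the $A_i$ (the Bose–Mesner algebra) has a basis of pairwise orthogonal idempotents $E_0=\frac1{|\mathcal P|}J,E_1,\dots,E_d$ with $A_iE_j=p_i(j)E_j$; $V_j$ is the column space of $E_j$. The matrix of eigenvalues is $\mathbf P$ with entry $p_i(j)$ in row $j$, column $i$; the matrix of dual eigenvalues is $\mathbf Q=|\mathcal P|\,\mathbf P^{-1}$. *)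

(* Defs.v *)
From mathcomp Require Import all_boot all_order all_algebra.
From mathcomp Require Import polyXY reals.

Set Implicit Arguments.
Unset Strict Implicit.
Unset Printing Implicit Defensive.

Import Order.TTheory GRing.Theory Num.Theory.
Local Open Scope ring_scope.

Definition assoc_scheme (T : finType) (d : nat) (Rel : 'I_d.+1 -> rel T) : Prop :=
  [/\ forall x y, exists! i, Rel i x y,
      forall i, exists x y, Rel i x y,
      forall i, symmetric (Rel i),
      forall x y, Rel ord0 x y = (x == y)
    & forall i j k, exists p : nat,
        forall x y, Rel k x y -> #|[set z | Rel i x z && Rel j y z]| = p].

Definition adjmx (K : realType) (T : finType) (r : rel T) : 'M[K]_#|T| :=
  \matrix_(x, y) (r (enum_val x) (enum_val y))%:R.

Definition bose_mesner (K : realType) (T : finType) (d : nat)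
    (Rel : 'I_d.+1 -> rel T) : {vspace 'M[K]_#|T|} :=
  <<[seq adjmx K (Rel i) | i : 'I_d.+1]>>%VS.

(* The eigenspace V_j is the column space of E j. *)
Definition idempotent_basis (K : realType) (T : finType) (d : nat)
    (Rel : 'I_d.+1 -> rel T) (E : 'I_d.+1 -> 'M[K]_#|T|) : Prop :=
  [/\ basis_of (bose_mesner K Rel) [seq E j | j : 'I_d.+1],
      forall i j, E i *m E j = if i == j then E i else 0
    & E ord0 = (#|T|%:R)^-1 *: const_mx 1].

Definition eigenmatrix (K : realType) (T : finType) (d : nat)
    (Rel : 'I_d.+1 -> rel T) (E : 'I_d.+1 -> 'M[K]_#|T|) (P : 'M[K]_d.+1) : Prop :=
  forall i j, adjmx K (Rel i) *m E j = P j i *: E j.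

Definition dual_eigenmatrix (K : realType) (T : finType) (d : nat)
    (P Q : 'M[K]_d.+1) : Prop :=
  P \in unitmx /\ Q = #|T|%:R *: invmx P.

Definition scheme_with_eigenmatrices (K : realType) (T : finType) (d : nat)
    (Rel : 'I_d.+1 -> rel T) (P Q : 'M[K]_d.+1) : Prop :=
  assoc_scheme Rel /\
  exists E : 'I_d.+1 -> 'M[K]_#|T|,
    [/\ idempotent_basis Rel E, eigenmatrix Rel E P & dual_eigenmatrix T P Q].

(* a X^2 + b X Y + c Y^2 as an element of F[Y][X]. *)
Definition bqf (F : fieldType) (a b c : F) : {poly {poly F}} :=
  a%:P%:P * 'X ^+ 2 + b%:P%:P * 'X * 'Y + c%:P%:P * 'Y ^+ 2.

(* The polar form of f has trivial radical. *)
Definition bqf_nondegenerate (F : fieldType) (f : {poly {poly F}}) : Prop :=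
  forall x y : F,
    (forall x' y', f.[x + x', y + y'] - f.[x, y] - f.[x', y'] = 0) ->
    x = 0 /\ y = 0.

(* Reducibility in F[X, Y], whose units are the non-zero constants. *)
Definition reducible_bipoly (F : fieldType) (f : {poly {poly F}}) : Prop :=
  exists g h : {poly {poly F}},
    [/\ g \isn't a GRing.unit, h \isn't a GRing.unit & f = g * h].

Definition irreducible_bipoly (F : fieldType) (f : {poly {poly F}}) : Prop :=
  [/\ f != 0, f \isn't a GRing.unit & ~ reducible_bipoly f].

(* x_0 x_1 + x_2 x_3 + ... + x_(n-3) x_(n-2) + f(x_(n-1), x_n), for n odd. *)
Definition kappa (F : fieldType) (n : nat) (f : {poly {poly F}})
    (x : 'rV[F]_n.+1) : F :=
  \sum_(i < n.-1./2) x 0 (inord i.*2) * x 0 (inord i.*2.+1)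
  + f.[x 0 (inord n.-1), x 0 (inord n)].

Section Quadric.

Variables (F : finFieldType) (n : nat) (f : {poly {poly F}}).
Implicit Types (X Y Z : 'M[F]_n.+1) (x : 'rV[F]_n.+1).

(* A point is a one-dimensional subspace of F^(n+1), encoded as the row space
   of the unique matrix X that spans it and is normalized by <<_>>%MS, so that
   equality of points is Leibniz equality. *)
Definition pgpoint X : bool := (<<X>>%MS == X) && (\rank X == 1%N).

Definition coordv X x : bool := (x != 0) && (x <= X)%MS.

Definition on_quadric X : bool :=
  pgpoint X && [forall x, coordv X x ==> (kappa f x == 0)].

Definition anisotropic X : bool := pgpoint X && ~~ on_quadric X.

Local Notation aniso_point := {X : 'M[F]_n.+1 | anisotropic X}.

Definition nzsquares : {set F} := [set a ^+ 2 | a in [set~ 0]].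
Definition nonsquares : {set F} := ~: [set a ^+ 2 | a : F].

Definition quadtype X : {set F} :=
  if [exists x, coordv X x && (kappa f x \in nzsquares)]
  then nzsquares else nonsquares.

(* S.S = S'.S' = S and S.S' = S'.S = S' for S := nzsquares, S' := nonsquares. *)
Definition mulqt (A B : {set F}) : {set F} :=
  if A == B then nzsquares else nonsquares.

Definition line_meets X Y : nat :=
  #|[set Z | on_quadric Z && (Z <= X + Y)%MS]|.

Definition quadrel (i : 'I_6) (X Y : aniso_point) : bool :=
  let k := line_meets (val X) (val Y) in
  let t := mulqt (quadtype (val X)) (quadtype (val Y)) in
  match val i with
  | 0 => X == Y
  | 1 => (X != Y) && (k == 1)
  | 2 => [&& X != Y, k == 2 & t == nzsquares]
  | 3 => [&& X != Y, k == 0 & t == nzsquares]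
  | 4 => [&& X != Y, k == 2 & t == nonsquares]
  | _ => [&& X != Y, k == 0 & t == nonsquares]
  end%N.

End Quadric.

Definition mx_of_rows (K : realType) (k : nat) (rows : seq (seq K)) : 'M[K]_k :=
  \matrix_(i, j) (nth [::] rows i)`_j.

Definition Pmx (K : realType) (q e : K) (n : nat) : 'M[K]_6 :=
  let m := n.-1./2 in
  mx_of_rows 6 [::
  [:: 1; q ^+ n.-1 - 1;
      1 / 4 * q ^+ m * (q ^+ m + e) * (q - 3);
      1 / 4 * q ^+ m * (q ^+ m - e) * (q - 1);
      1 / 4 * q ^+ m * (q ^+ m + e) * (q - 1);
      1 / 4 * q ^+ m * (q ^+ m - e) * (q + 1)];
  [:: 1; q ^+ n.-1 - 1;
      1 / 4 * q ^+ m * (q ^+ m + e) * (q - 3);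
      1 / 4 * q ^+ m * (q ^+ m - e) * (q - 1);
      - (1 / 4 * q ^+ m * (q ^+ m + e) * (q - 1));
      - (1 / 4 * q ^+ m * (q ^+ m - e) * (q + 1))];
  [:: 1; e * q ^+ m.-1 - 1;
      1 / 4 * e * q ^+ m.-1 * (q + 1) * (q - 3);
      - (1 / 4 * e * q ^+ m.-1 * (q - 1) ^+ 2);
      1 / 4 * e * q ^+ m.-1 * (q - 1) * (q + 1);
      - (1 / 4 * e * q ^+ m.-1 * (q - 1) * (q + 1))];
  [:: 1; e * q ^+ m.-1 - 1;
      1 / 4 * e * q ^+ m.-1 * (q + 1) * (q - 3);
      - (1 / 4 * e * q ^+ m.-1 * (q - 1) ^+ 2);
      - (1 / 4 * e * q ^+ m.-1 * (q - 1) * (q + 1));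
      1 / 4 * e * q ^+ m.-1 * (q - 1) * (q + 1)];
  [:: 1; e * q ^+ m - 1; - (e * q ^+ m); 0; 0; 0];
  [:: 1; - (e * q ^+ m) - 1; 0; e * q ^+ m; 0; 0]].

Definition Qmx (K : realType) (q e : K) (n : nat) : 'M[K]_6 :=
  let m := n.-1./2 in
  mx_of_rows 6 [::
  [:: 1; 1;
      q ^+ 2 * ((q ^+ n.-1 - 1) / (q ^+ 2 - 1));
      q ^+ 2 * ((q ^+ n.-1 - 1) / (q ^+ 2 - 1));
      (q - 3) / (2 * (q - 1)) * (q ^+ m + e) * (q ^+ m.+1 - e);
      (q - 1) / (2 * (q + 1)) * (q ^+ m - e) * (q ^+ m.+1 - e)];
  [:: 1; 1;
      q ^+ 2 * ((e * q ^+ m.-1 - 1) / (q ^+ 2 - 1));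
      q ^+ 2 * ((e * q ^+ m.-1 - 1) / (q ^+ 2 - 1));
      e * ((q - 3) / (2 * (q - 1))) * (q ^+ m.+1 - e);
      - (e * ((q - 1) / (2 * (q + 1))) * (q ^+ m.+1 - e))];
  [:: 1; 1;
      e * (q / (q - 1)) * (q ^+ m - e);
      e * (q / (q - 1)) * (q ^+ m - e);
      - (e * (2 / (q - 1)) * (q ^+ m.+1 - e));
      0];
  [:: 1; 1;
      - (e * (q / (q + 1)) * (q ^+ m + e));
      - (e * (q / (q + 1)) * (q ^+ m + e));
      0;
      e * (2 / (q + 1)) * (q ^+ m.+1 - e)];
  [:: 1; -1;
      e * (q / (q - 1)) * (q ^+ m - e);
      - (e * (q / (q - 1)) * (q ^+ m - e));
      0; 0];
  [:: 1; -1;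
      - (e * (q / (q + 1)) * (q ^+ m + e));
      e * (q / (q + 1)) * (q ^+ m + e);
      0; 0]].

(* Main.v *)
(* Put q = #|F|, x = q^m and delta s = q [s = 0] - 1. Counting the zeros of kappa
   on a hyperplane u^perp amounts to the self-duality
     sum_v delta (kappa v) delta (B u v) = eps q x (q - 1) delta (kappa u),
   obtained for singular u by translating along u and then for anisotropic u by
   Parseval. Since delta s delta t = sum_(l <> 0) delta (s + l t), it also counts
   the singular vectors orthogonal to two vectors in terms of the zeros of kappa on
   the line they span, hence of the relation between two points.

   Let W be the incidence matrix between anisotropic points and singular vectors,
   D the diagonal matrix of quadratic types (+1 or -1), J the all-one matrix and
   S = A_0 + A_1. Then W W^T is a multiple of a projection M, whose entries depend
   only on R_0, ..., R_5, and one finds M J = J, M D M = 0,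
   S M = (eps x / q) M + J / q, S D = D S, and S^2 as a combination of I, J + D J D
   and M + D M D. With N the number of points, M - J / N and its conjugate by D are
   the projections onto V_2 and V_3; on the complement of their sum with J and D J D
   the matrix S squares to x^2, which splits it into V_4 and V_5. The entries of these
   six idempotents are the columns of Q / N, and P Q = N I turns them into an
   association scheme.
   For q = 3, A_2 has zero row sums, so R_2 is empty. *)

Require Import Defs.
From mathcomp Require Import all_boot all_order all_algebra.
From mathcomp Require Import polyXY reals.
From mathcomp Require Import ring lra zify.

Set Implicit Arguments.
Unset Strict Implicit.
Unset Printing Implicit Defensive.

Import Order.TTheory GRing.Theory Num.Theory.
Local Open Scope ring_scope.

(** * Additive and quadratic character sums over a finite field *)

Section FieldSums.

Variables (K : realFieldType) (F : finFieldType).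
Implicit Types (s t a b c l : F).

Local Notation q := (#|F|%:R : K).

Lemma card_gt1 : (1 < #|F|)%N.
Proof. by rewrite (cardD1 0) (cardD1 1) !inE oner_neq0. Qed.

Lemma q_neq0 : q != 0.
Proof. by rewrite pnatr_eq0 -lt0n ltnW // card_gt1. Qed.

Lemma sum_pred1 (T : finType) (c : T) (h : T -> K) :
  \sum_s (s == c)%:R * h s = h c.
Proof.
rewrite (bigD1 c) //= eqxx mul1r big1 ?addr0 // => i /negPf->.
by rewrite mul0r.
Qed.

Lemma sum_indicator (T : finType) (c : T) : \sum_s (s == c)%:R = 1 :> K.
Proof.
rewrite -[RHS](sum_pred1 c (fun=> 1)).
by apply: eq_bigr => s _; rewrite mulr1.
Qed.

Lemma sum_const_type (T : finType) (k : K) : \sum_(s : T) k = #|T|%:R * k.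
Proof. by rewrite sumr_const mulr_natl. Qed.

Lemma sum_neq0 (h : F -> K) : \sum_(l | l != 0) h l = \sum_l h l - h 0.
Proof. by rewrite [in RHS](bigD1 0) //= addrC addrK. Qed.

(* The sum of the non-trivial additive characters of F at s: delta_mul, fourierE
   and gramE below are character sum identities in disguise. *)
Definition delta s : K := q * (s == 0)%:R - 1.

Lemma delta0 : delta 0 = q - 1.
Proof. by rewrite /delta eqxx mulr1. Qed.

Lemma delta_neq0 s : s != 0 -> delta s = -1.
Proof. by rewrite /delta => /negPf->; rewrite mulr0 sub0r. Qed.

Lemma indicatorE s : (s == 0)%:R = (1 + delta s) / q.
Proof. by rewrite /delta addrC subrK mulrAC divff ?mul1r // q_neq0. Qed.

Lemma sum_delta : \sum_s delta s = 0.
Proof.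
by rewrite sumrB sum_const_type mulr1 -mulr_sumr sum_indicator mulr1 subrr.
Qed.

Lemma deltaM l s : l != 0 -> delta (l * s) = delta s.
Proof. by move=> l0; rewrite /delta mulf_eq0 (negPf l0). Qed.

Lemma sum_affine (h : F -> K) a b : b != 0 ->
  \sum_l h (a + l * b) = \sum_s h s.
Proof.
move=> b0; rewrite [RHS](reindex (fun l => a + l * b)) //=.
exists (fun s => (s - a) / b) => s _.
  by rewrite addrC addKr mulfK.
by rewrite mulfVK // addrC subrK.
Qed.

(** If [b <> 0], then [a + l * b] runs over all of [F], where [delta] sums to 0, so leaving out
    [l = 0] gives [- delta a]. *)
Lemma delta_mul a b : delta a * delta b = \sum_(l | l != 0) delta (a + l * b).
Proof.
have [->|b0] := eqVneq b 0.
  under eq_bigr do rewrite mulr0 addr0.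
  rewrite sum_neq0 sum_const_type delta0; ring.
by rewrite sum_neq0 sum_affine // sum_delta mul0r addr0 sub0r (delta_neq0 b0) mulrN1.
Qed.

(** The quadratic character of [F], extended by 0. *)
Definition chi s : K :=
  if s == 0 then 0 else if [exists t, t ^+ 2 == s] then 1 else -1.

Lemma chi0 : chi 0 = 0. Proof. by rewrite /chi eqxx. Qed.

Lemma chi_sqrM l s : l != 0 -> chi (l ^+ 2 * s) = chi s.
Proof.
move=> l0; rewrite /chi mulf_eq0 expf_eq0 (negPf l0) /=; case: eqP => // _.
congr (if _ then _ else _); apply/existsP/existsP => -[t /eqP Et].
  by exists (t / l); rewrite expr_div_n Et mulrAC divff ?mul1r // expf_neq0.
by exists (l * t); rewrite exprMn Et.
Qed.

Lemma chi_sqr l : l != 0 -> chi (l ^+ 2) = 1.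
Proof.
move=> l0; rewrite /chi expf_eq0 (negPf l0) andbF.
by case: existsP => // -[]; exists l.
Qed.

Lemma chi_sqr1 s : s != 0 -> chi s * chi s = 1.
Proof.
by rewrite /chi => /negPf->; case: ifP => _; rewrite ?mulrNN mulr1.
Qed.

Lemma chi_neq0 s : s != 0 -> chi s = 1 \/ chi s = -1.
Proof. by rewrite /chi => /negPf->; case: ifP => _; [left|right]. Qed.

Hypothesis F_odd : odd #|F|.

(** Shifting the sum of all field elements by 1 shows that [#|F|] is zero in [F]; an odd number
    would be 1 there if 2 were 0. *)
Lemma two_neq0 : (2 : F) != 0.
Proof.
have card0 : #|F|%:R = 0 :> F.
  apply: (@addrI _ (\sum_x (x : F))); rewrite addr0.
  rewrite [RHS](reindex_inj (addIr (1 : F))) /= big_split /=.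
  by rewrite sumr_const.
apply/eqP => two0; move: card0.
rewrite -(odd_double_half #|F|) F_odd natrD -muln2 natrM two0 mulr0 addr0.
by move/eqP; rewrite oner_eq0.
Qed.

Lemma sqrt_count s : \sum_t (t ^+ 2 == s)%:R = 1 + chi s.
Proof.
rewrite /chi; have [->|s0] := eqVneq s 0.
  by under eq_bigr do rewrite expf_eq0 /=; rewrite sum_indicator addr0.
case: existsP => [[r /eqP Er]|no_root]; last first.
  rewrite subrr big1 // => t _; case: eqP => // Et; case: no_root.
  by exists t; apply/eqP.
have r0 : r != 0 by apply: contraNneq s0 => r0; rewrite -Er r0 expr0n.
have rN : - r != r.
  rewrite eq_sym -subr_eq0 opprK -mulr2n -mulr_natr mulf_eq0 negb_or r0.
  exact: two_neq0.
have Et t : (t ^+ 2 == s)%:R = (t == r)%:R + (t == - r)%:R :> K.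
  rewrite -Er eqf_sqr; have [->|_] /= := eqVneq t r.
    by rewrite eq_sym (negPf rN) addr0.
  by rewrite add0r.
by rewrite (eq_bigr _ (fun t _ => Et t)) big_split /= !sum_indicator.
Qed.

Lemma sum_chi : \sum_s chi s = 0.
Proof.
have E s : chi s = \sum_t (t ^+ 2 == s)%:R - 1 by rewrite sqrt_count [RHS]addrC addKr.
rewrite (eq_bigr _ (fun s _ => E s)).
rewrite sumrB exchange_big /= [X in X - _](_ : _ = \sum_(t : F) 1) ?subrr //.
apply: eq_bigr => t _.
under eq_bigr => s _ do rewrite eq_sym.
by rewrite sum_indicator.
Qed.

(** Completing the square: [4 * a] times the polynomial is [(b + l * (2 * a)) ^+ 2] minus the
    discriminant, and [l |-> b + l * (2 * a)] is a bijection. *)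
Lemma quadratic_count a b c : a != 0 ->
  \sum_l (a * l ^+ 2 + b * l + c == 0)%:R = 1 + chi (b ^+ 2 - 4 * a * c).
Proof.
move=> a0; rewrite -sqrt_count -(sum_affine (fun t => (t ^+ 2 == _)%:R) b (b := 2 * a)).
  apply: eq_bigr => l _; congr (nat_of_bool _)%:R.
  rewrite -[RHS]subr_eq0.
  have -> : (b + l * (2 * a)) ^+ 2 - (b ^+ 2 - 4 * a * c) =
            2 * 2 * a * (a * l ^+ 2 + b * l + c) by ring.
  by rewrite mulf_eq0 !mulf_eq0 (negPf a0) (negPf two_neq0).
by rewrite mulf_neq0 // two_neq0.
Qed.

(** [1 + chi (t ^+ 2 - c)] counts the points of the hyperbola [t ^+ 2 - s ^+ 2 = c] above [t], and
    there are [q - 1] points in all. *)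
Lemma sum_chi_sqrB c : c != 0 -> \sum_t chi (t ^+ 2 - c) = -1.
Proof.
move=> c0.
have E t : chi (t ^+ 2 - c) = \sum_s (s ^+ 2 == t ^+ 2 - c)%:R - 1.
  by rewrite sqrt_count [RHS]addrC addKr.
under eq_bigr do rewrite E.
rewrite sumrB sum_const_type mulr1 exchange_big /=.
(* t^2 - s^2 = c becomes (2 s + u) u = c for u = t - s. *)
have Es s : \sum_t (s ^+ 2 == t ^+ 2 - c)%:R =
            \sum_u (u * (u + s * 2) == c)%:R :> K.
  rewrite (reindex (fun u => u + s)) /=; last first.
    by exists (fun t => t - s) => t _; rewrite ?addrK ?subrK.
  apply: eq_bigr => u _; congr (nat_of_bool _)%:R.
  rewrite -subr_eq0 -[RHS]subr_eq0 -oppr_eq0; congr (_ == 0); ring.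
under eq_bigr do rewrite Es.
rewrite exchange_big /= (bigD1 0) //= [X in X + _ - _]big1 ?add0r; last first.
  by move=> s _; rewrite mul0r eq_sym (negPf c0).
rewrite (eq_bigr (fun=> 1)).
  by rewrite sum_neq0 sum_const_type mulr1 addrC addKr.
move=> u u0.
have Eu t : (u * (u + t * 2) == c)%:R = (u + t * 2 == c / u)%:R :> K.
  by rewrite -(inj_eq (mulfI u0) _ (c / u)) mulrCA divff // mulr1.
under eq_bigr do rewrite Eu.
rewrite (sum_affine (fun s => (s == c / u)%:R)); last exact: two_neq0.
by rewrite sum_indicator.
Qed.

Lemma chi1_root s : chi s = 1 -> exists2 l, l != 0 & s = l ^+ 2.
Proof.
rewrite /chi; case: eqP => [_ /eqP|/eqP s0]; first by rewrite eq_sym oner_eq0.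
case: existsP => [[l /eqP El] _|_ /eqP].
  by exists l => //; apply: contraNneq s0 => l0; rewrite -El l0 expr0n.
by rewrite -subr_eq0 -opprD oppr_eq0 (pnatr_eq0 _ 2).
Qed.

(* For a non-square s, chi (s t) + chi t <= 0 termwise, while both sum to 0. *)
Lemma chiM s t : chi (s * t) = chi s * chi t.
Proof.
have [->|s0] := eqVneq s 0; first by rewrite mul0r chi0 mul0r.
have [/[dup] s1 /chi1_root[l l0 ->]|sN1] := chi_neq0 s0.
  by rewrite chi_sqrM // chi_sqr // mul1r.
have le0 u : 0 <= - (chi (s * u) + chi u).
  have [->|u0] := eqVneq u 0; first by rewrite mulr0 chi0 addr0 oppr0.
  have [/[dup] u1 /chi1_root[l l0 El]|->] := chi_neq0 u0.
    by rewrite {1}El mulrC chi_sqrM // sN1 u1 addNr oppr0.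
  have [->|->] := chi_neq0 (mulf_neq0 s0 u0); first by rewrite subrr oppr0.
  by rewrite oppr_ge0 -opprD oppr_le0 addr_ge0.
have sum0 : \sum_u - (chi (s * u) + chi u) = 0.
  rewrite sumrN big_split /= sum_chi addr0.
  rewrite (eq_bigr (fun u => chi (0 + u * s))); last by move=> u _; rewrite add0r mulrC.
  by rewrite sum_affine // sum_chi oppr0.
have /eqP : - (chi (s * t) + chi t) = 0 by apply: (psumr_eq0P (fun u _ => le0 u) sum0).
by rewrite oppr_eq0 addr_eq0 sN1 mulN1r => /eqP.
Qed.

Lemma chi_eq_ratio s t : s != 0 -> t != 0 -> chi s = chi t ->
  exists2 l, l != 0 & t = l ^+ 2 * s.
Proof.
move=> s0 t0 Est; have [|l l0 El] := @chi1_root (t * s).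
  by rewrite chiM Est chi_sqr1.
exists (l / s); first by rewrite mulf_neq0 ?invr_eq0.
by rewrite expr_div_n -El; field.
Qed.

End FieldSums.

(** * Counting in a quadratic space of even dimension *)

Section QuadraticSpace.

Variables (K : realFieldType) (F : finFieldType) (N : nat).
Local Notation V := 'rV[F]_N.
Variables (kap : V -> F) (B : V -> V -> F).
Implicit Types (u v w x y z p : V) (s t a b l : F).

Local Notation q := (#|F|%:R : K).
Local Notation delta := (delta K).
Local Notation chi := (chi K).

Hypothesis F_odd : odd #|F|.
Hypothesis kapZ : forall a x, kap (a *: x) = a ^+ 2 * kap x.
Hypothesis kapD : forall x y, kap (x + y) = kap x + kap y + B x y.
Hypothesis BDl : forall x y z, B (x + y) z = B x z + B y z.
Hypothesis BZl : forall a x y, B (a *: x) y = a * B x y.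
Hypothesis B_nondeg : forall x, (forall y, B x y = 0) -> x = 0.

(* e is the sign of the quadric and X = q^m, so that the dimension is 2m + 2. *)
Variables (e X : K).
Hypothesis e_sqr : e * e = 1.
Hypothesis card_V : #|{: V}|%:R = (q * X) ^+ 2.
Local Notation E := (e * (q * X) * (q - 1)).
(** This fixes the number of singular vectors (see [card_singular]), hence the sign of the form;
    [sum_chi_kap] says that non-zero squares and non-squares are taken equally often. *)
Hypothesis sum_delta_kap : \sum_v delta (kap v) = E.
Hypothesis sum_chi_kap : \sum_v chi (kap v) = 0.

Lemma B_sym x y : B x y = B y x.
Proof.
apply: (addrI (kap x + kap y)); rewrite -kapD [x + y]addrC kapD.
by rewrite [kap y + _]addrC.
Qed.

Lemma BDr x y z : B z (x + y) = B z x + B z y.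
Proof. by rewrite !(B_sym z) BDl. Qed.

Lemma BZr a x y : B x (a *: y) = a * B x y.
Proof. by rewrite !(B_sym x) BZl. Qed.

Lemma B0r x : B x 0 = 0.
Proof. by rewrite -(scale0r 0) BZr mul0r. Qed.

Lemma B0l x : B 0 x = 0.
Proof. by rewrite B_sym B0r. Qed.

Lemma kap0 : kap 0 = 0.
Proof. by rewrite -(scale0r 0) kapZ expr0n mul0r. Qed.

Lemma Bxx x : B x x = 2 * kap x.
Proof.
have := kapD x x; rewrite -mulr2n -scaler_nat kapZ => E2.
by apply: (addrI (kap x + kap x)); rewrite -E2; ring.
Qed.

Lemma kapN x : kap (- x) = kap x.
Proof. by rewrite -scaleN1r kapZ sqrrN expr1n mul1r. Qed.

Lemma delta_BN x y : delta (B (- x) y) = delta (B x y).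
Proof. by rewrite -scaleN1r BZl deltaM // oppr_eq0 oner_eq0. Qed.

Local Notation q0 := (q_neq0 K F).

Lemma q_sub1_neq0 : q - 1 != 0.
Proof. by rewrite subr_eq0 (eqr_nat K _ 1) gtn_eqF // card_gt1. Qed.

(** * Sums along lines and orthogonality relations *)

Lemma sum_translate (phi : V -> K) p : \sum_v phi v = \sum_v phi (v + p).
Proof. by rewrite (reindex_inj (addIr p)). Qed.

(** Many cancellations below come from this averaging: a sum over the space is broken into sums
    along the lines in a well-chosen direction [p]. *)
Lemma sum_average (phi : V -> K) p :
  \sum_v phi v = q^-1 * \sum_v \sum_t phi (v + t *: p).
Proof.
rewrite exchange_big /= [X in _ * X](eq_bigr (fun=> \sum_v phi v)).
  by rewrite sum_const_type mulKf // q0.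
by move=> t _; rewrite -sum_translate.
Qed.

Lemma sum_linear (h : F -> K) u c :
  \sum_s h s = 0 -> u != 0 -> \sum_v h (c + B u v) = 0.
Proof.
move=> h0 u0.
have [w Bw] : exists w, B u w != 0.
  apply/existsP; apply: contraNT u0 => /existsPn Bu.
  by apply/eqP/B_nondeg => y; apply/eqP; rewrite -[_ == _]negbK.
rewrite (sum_average _ w) big1 ?mulr0 // => v _.
under eq_bigr do rewrite BDr BZr addrA.
by rewrite sum_affine.
Qed.

(** For non-zero vectors this is 1 or 0 according to whether they span the same point; for
    [x = y = 0] it is [q - 1], which lets [sum_delta_B2] hold without exceptions. *)
Definition parallel x y : K := \sum_(l | l != 0) (x + l *: y == 0)%:R.

Lemma sum_delta_B u : \sum_v delta (B u v) = (u == 0)%:R * (#|{: V}|%:R * (q - 1)).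
Proof.
have [->|u0] := eqVneq u 0.
  under eq_bigr do rewrite B0l.
  by rewrite sum_const_type delta0 mul1r.
under eq_bigr do rewrite -[B u _]add0r.
by rewrite mul0r sum_linear // sum_delta.
Qed.

Lemma sum_delta_B2 x y :
  \sum_v delta (B x v) * delta (B y v) = #|{: V}|%:R * (q - 1) * parallel x y.
Proof.
under eq_bigr do rewrite delta_mul.
rewrite exchange_big /= mulr_sumr; apply: eq_bigr => l _.
under eq_bigr do rewrite -BZl -BDl.
by rewrite sum_delta_B mulrC.
Qed.

(* For singular p, z |-> z + t p moves kap z uniformly over F unless z is
   orthogonal to p. *)
Lemma sum_not_orthogonal (h : F -> K) (phi : V -> K) p :
    \sum_s h s = 0 -> kap p = 0 -> (forall z t, phi (z + t *: p) = phi z) ->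
  \sum_v (B p v != 0)%:R * (phi v * h (kap v)) = 0.
Proof.
move=> h0 p0 phiP; rewrite (sum_average _ p) big1 ?mulr0 // => v _.
under eq_bigr => t _.
  rewrite phiP BDr BZr Bxx p0 2!mulr0 addr0 kapD kapZ p0 mulr0 addr0 BZr; over.
rewrite -2!mulr_sumr; have [_|Bv] := eqVneq; first by rewrite mul0r.
by rewrite sum_affine ?h0 ?mulr0 // B_sym.
Qed.

Lemma delta_notE s : delta s = (q - 1) - q * (s != 0)%:R.
Proof.
have [->|s0] := eqVneq s 0; first by rewrite delta0 mulr0 subr0.
by rewrite delta_neq0 // mulr1; ring.
Qed.

(** [delta (B p v)] is the constant [q - 1] minus a multiple of the indicator of [B p v != 0], and
    the non-orthogonal vectors contribute nothing by [sum_not_orthogonal]. *)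
Lemma sum_singular_delta (h : F -> K) (phi : V -> K) p :
    \sum_s h s = 0 -> kap p = 0 -> (forall z t, phi (z + t *: p) = phi z) ->
  \sum_v delta (B p v) * (phi v * h (kap v)) = (q - 1) * \sum_v phi v * h (kap v).
Proof.
move=> h0 p0 phiP.
under eq_bigr do rewrite delta_notE mulrBl -[q * _ * _]mulrA.
by rewrite sumrB -!mulr_sumr (sum_not_orthogonal h0 p0 phiP) mulr0 subr0.
Qed.

(** Up to a factor [q - 1], the Fourier transform of [delta (kap v)]: this function is invariant
    under non-zero scalars, so all nontrivial characters contribute equally. *)
Definition fourier u := \sum_v delta (kap v) * delta (B u v).

Lemma fourier_singular u : kap u = 0 -> fourier u = (q - 1) * E.
Proof.
move=> u0; have := sum_singular_delta (phi := fun=> 1) (sum_delta K F) u0.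
under eq_bigr do rewrite mul1r mulrC; rewrite -/(fourier u) => -> //.
by under eq_bigr do rewrite mul1r; rewrite sum_delta_kap.
Qed.

Lemma sum_singular (phi : V -> K) :
  \sum_(v | kap v == 0) phi v = (\sum_v phi v + \sum_v delta (kap v) * phi v) / q.
Proof.
rewrite -big_split /= mulr_suml big_mkcond /=; apply: eq_bigr => v _.
rewrite -[in RHS](mul1r (phi v)) mulrA mulr1 -mulrDl mulrAC -indicatorE.
by case: eqP; rewrite ?mul1r ?mul0r.
Qed.

Lemma parallel_sum (phi : V -> K) w :
  \sum_v phi v * parallel v w = \sum_(l | l != 0) phi (- (l *: w)).
Proof.
under eq_bigr do rewrite mulr_sumr; rewrite exchange_big /=.
apply: eq_bigr => l _; under eq_bigr do rewrite addr_eq0 mulrC.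
by rewrite sum_pred1.
Qed.

Lemma sum_const_neq0 (c : K) : \sum_(l : F | l != 0) c = (q - 1) * c.
Proof. by rewrite sum_neq0 sum_const_type mulrBl mul1r. Qed.

(** Summing over [u] first leaves only [v = 0], by orthogonality of characters. *)
Lemma sum_fourier : \sum_u fourier u = #|{: V}|%:R * (q - 1) ^+ 2.
Proof.
rewrite exchange_big /= (eq_bigr (fun v => (v == 0)%:R * (delta (kap v) *
   (#|{: V}|%:R * (q - 1))))); last first.
  move=> v _; under eq_bigr do rewrite B_sym.
  by rewrite -mulr_sumr sum_delta_B mulrCA.
rewrite sum_pred1 kap0 delta0; ring.
Qed.

(** [delta] takes only the values [q - 1] and -1, the roots of [T^2 = (q - 2) T + (q - 1)]. *)
Lemma sum_delta_sqr :
  \sum_v delta (kap v) ^+ 2 = (q - 2) * E + (q - 1) * #|{: V}|%:R.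
Proof.
rewrite (eq_bigr (fun v => (q - 2) * delta (kap v) + (q - 1))).
  rewrite big_split /= -mulr_sumr sum_delta_kap sum_const_type; ring.
move=> v _; have [->|k0] := eqVneq (kap v) 0; first by rewrite delta0; ring.
by rewrite delta_neq0 //; ring.
Qed.

(** Parseval's identity: after expanding the square, summing over [u] kills every pair of vectors
    that are not parallel. *)
Lemma sum_fourier_sqr : \sum_u fourier u ^+ 2 =
  #|{: V}|%:R * (q - 1) ^+ 2 * ((q - 2) * E + (q - 1) * #|{: V}|%:R).
Proof.
have Eu u : fourier u ^+ 2 = \sum_w \sum_v
    delta (kap v) * delta (kap w) * (delta (B v u) * delta (B w u)).
  rewrite expr2 mulr_sumr; apply: eq_bigr => w _.
  rewrite mulr_suml; apply: eq_bigr => v _.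
  by rewrite !(B_sym u); ring.
rewrite (eq_bigr _ (fun u _ => Eu u)) exchange_big /=.
rewrite -sum_delta_sqr mulr_sumr; apply: eq_bigr => w _.
rewrite exchange_big /=.
under eq_bigr do rewrite -mulr_sumr sum_delta_B2 mulrCA.
rewrite -mulr_sumr parallel_sum (eq_bigr (fun=> delta (kap w) ^+ 2)).
  rewrite sum_const_neq0; ring.
by move=> l l0; rewrite kapN kapZ deltaM ?expf_neq0.
Qed.

Lemma card_singular : \sum_(v | kap v == 0) 1 = (#|{: V}|%:R + E) / q.
Proof.
rewrite sum_singular sum_const_type mulr1; congr ((_ + _) / _).
by under eq_bigr do rewrite mulr1.
Qed.

(* Parseval: the squares of fourier u + E over the singular u already account
   for the whole l2 norm. *)
Lemma fourierE u : fourier u = E * delta (kap u).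
Proof.
have [u0|u0] := eqVneq (kap u) 0.
  by rewrite fourier_singular // u0 delta0 mulrC.
have total : \sum_u (fourier u + E) ^+ 2 =
    \sum_(u | kap u == 0) (fourier u + E) ^+ 2.
  transitivity (q * E ^+ 2 * (#|{: V}|%:R + E)).
    have Ev v : (fourier v + E) ^+ 2 = fourier v ^+ 2 + 2 * E * fourier v + E ^+ 2.
      by ring.
    rewrite (eq_bigr _ (fun v _ => Ev v)) !big_split /= -mulr_sumr.
    rewrite sum_fourier sum_fourier_sqr sum_const_type card_V.
    have -> : E ^+ 2 = (e * e) * (q * X) ^+ 2 * (q - 1) ^+ 2 by ring.
    rewrite e_sqr; ring.
  rewrite (eq_bigr (fun=> (q * E) ^+ 2 * 1)).
    by rewrite -mulr_sumr card_singular; field; exact: q0.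
  by move=> v /eqP v0; rewrite fourier_singular //; ring.
move: total; rewrite (bigID (fun u => kap u == 0)) /= => /eqP.
rewrite addrC -subr_eq0 addrK => /eqP aniso0.
have /eqP := psumr_eq0P (fun v _ => sqr_ge0 (fourier v + E)) aniso0 u0.
by rewrite expf_eq0 /= addr_eq0 delta_neq0 // mulrN1 => /eqP.
Qed.

Lemma fourier2 x y : \sum_v delta (kap v) * (delta (B x v) * delta (B y v)) =
  E * \sum_(l | l != 0) delta (kap (x + l *: y)).
Proof.
under eq_bigr do rewrite delta_mul mulr_sumr.
rewrite exchange_big /= mulr_sumr; apply: eq_bigr => l _.
by rewrite -fourierE; apply: eq_bigr => v _; rewrite -BZl -BDl.
Qed.

Lemma sum_singular_B u : \sum_(v | kap v == 0) delta (B u v) =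
  ((u == 0)%:R * (#|{: V}|%:R * (q - 1)) + E * delta (kap u)) / q.
Proof. by rewrite sum_singular sum_delta_B -fourierE. Qed.

(** The entry of [W W^T], where the incidence of [x] with a singular vector [v] is weighted as
    [delta (B x v)]; the zero vector counts as singular. *)
Definition gram x y := \sum_(v | kap v == 0) delta (B x v) * delta (B y v).

Lemma gramE x y : gram x y =
  (#|{: V}|%:R * (q - 1) * parallel x y
   + E * \sum_(l | l != 0) delta (kap (x + l *: y))) / q.
Proof. by rewrite /gram sum_singular sum_delta_B2 fourier2. Qed.

(** The discriminant of the polynomial [kap (x + l *: y)] in [l]. For independent anisotropic [x]
    and [y], its [chi] is 0, 1 or -1 as the line they span is tangent, secant or external. *)
Definition disc x y := B x y ^+ 2 - 4 * kap y * kap x.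

Lemma disc_sym x y : disc x y = disc y x.
Proof. by rewrite /disc B_sym mulrAC. Qed.

Lemma kap_line x y l : kap (x + l *: y) = kap y * l ^+ 2 + B x y * l + kap x.
Proof. by rewrite kapD kapZ BZr; ring. Qed.

Lemma line_count x y : kap y != 0 ->
  \sum_l (kap (x + l *: y) == 0)%:R = 1 + chi (disc x y).
Proof.
move=> y0; under eq_bigr do rewrite kap_line.
by rewrite (quadratic_count K F_odd).
Qed.

Lemma gram_anisotropic x y : kap x != 0 -> kap y != 0 ->
  gram x y = (q - 1) * (e * X) *
             (1 + q * chi (disc x y) + e * q * X * parallel x y).
Proof.
(* The sum over all [l] is [q] times the number of zeros on the line minus [q], and the excluded
   term at [l = 0] is -1. *)
move=> x0 y0; rewrite gramE sum_neq0 scale0r addr0 (delta_neq0 K x0).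
rewrite /delta sumrB -mulr_sumr sum_const_type mulr1 line_count // card_V.
rewrite [_ * (e * X) * _](_ : _ = (q - 1) * (e * X) * (1 + q * chi (disc x y)) +
   e * e * ((q - 1) * q * X ^+ 2 * parallel x y)); last by ring.
by rewrite e_sqr; field; exact: q0.
Qed.

Lemma parallel_singular x w : kap x != 0 -> kap w = 0 -> parallel x w = 0.
Proof.
move=> x0 w0; apply: big1 => l _; case: eqP => // /eqP.
rewrite addr_eq0 => /eqP xE; move: x0.
by rewrite xE kapN kapZ w0 mulr0 eqxx.
Qed.

(** For singular [w], [kap] is affine along [x + l *: w], so [delta_mul] collapses the sum over the
    line to [delta (kap x) * delta (B x w)]. *)
Lemma gram_mixed x w : kap x != 0 -> kap w = 0 ->
  gram x w = - (E / q) * delta (B x w).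
Proof.
move=> x0 w0; rewrite gramE parallel_singular // mulr0 add0r.
have -> : \sum_(l | l != 0) delta (kap (x + l *: w)) = - delta (B x w).
  under eq_bigr do rewrite kap_line w0 mul0r add0r addrC mulrC.
  rewrite -delta_mul delta_neq0 // mulN1r //.
ring.
Qed.

Lemma gram_singular v w : kap v = 0 -> kap w = 0 ->
  gram v w = (#|{: V}|%:R * (q - 1) * parallel v w
              + E * ((q - 1) * delta (B v w))) / q.
Proof.
move=> v0 w0; rewrite gramE -sum_const_neq0; congr ((_ + _ * _) / _).
apply: eq_bigr => l l0.
by rewrite kap_line v0 w0 mul0r add0r addr0 mulrC deltaM.
Qed.

Lemma sum_anisotropic (phi : V -> K) :
  \sum_(v | kap v != 0) phi v = \sum_v phi v - \sum_(v | kap v == 0) phi v.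
Proof. by rewrite [in RHS](bigID (fun v => kap v == 0)) /= addrAC subrr add0r. Qed.

(** Up to scalars this says that [W W^T W] is a multiple of [W], the source of idempotence. After
    exchanging sums, the anisotropic [z] are all vectors minus the singular ones, which gives
    [sum_delta_B2] and [gram v w]. *)
Lemma gram_incidence x w : kap x != 0 -> kap w = 0 ->
  \sum_(z | kap z != 0) gram x z * delta (B z w) =
  (q - 1) ^+ 3 * X ^+ 2 * (q + 1) * delta (B x w).
Proof.
move=> x0 w0.
transitivity (\sum_(v | kap v == 0) delta (B x v) *
    \sum_(z | kap z != 0) delta (B v z) * delta (B w z)).
  under eq_bigr do rewrite mulr_suml.
  rewrite exchange_big /=; apply: eq_bigr => v _.
  by rewrite mulr_sumr; apply: eq_bigr => z _; rewrite (B_sym v) (B_sym w) mulrA.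
rewrite (eq_bigr (fun v => (1 - q^-1) * (#|{: V}|%:R * (q - 1)) *
     (delta (B x v) * parallel v w) - E * (q - 1) / q * (delta (B x v) * delta (B w v)))).
  rewrite sumrB -!mulr_sumr -/(gram x w) gram_mixed //.
  have -> : \sum_(v | kap v == 0) delta (B x v) * parallel v w =
            (q - 1) * delta (B x w).
    transitivity (\sum_v (if kap v == 0 then delta (B x v) else 0) * parallel v w).
      by rewrite big_mkcond; apply: eq_bigr => v _; case: ifP; rewrite ?mul0r.
    rewrite parallel_sum -sum_const_neq0; apply: eq_bigr => l l0.
    by rewrite kapN kapZ w0 mulr0 eqxx B_sym delta_BN BZl deltaM // B_sym.
  have -> : E * (q - 1) / q * (- (E / q) * delta (B x w)) =
     - (e * e * (X ^+ 2 * (q - 1) ^+ 3 * delta (B x w))).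
    by field; exact: q0.
  by rewrite e_sqr card_V; field; exact: q0.
move=> v /eqP v0; rewrite sum_anisotropic sum_delta_B2 -/(gram v w).
by rewrite gram_singular // (B_sym w); field; exact: q0.
Qed.

(* If B w v <> 0, translating z by v moves B w z uniformly over F while keeping
   kap z fixed on the hyperplane orthogonal to v. *)
Lemma chi_incidence v w : kap v = 0 -> kap w = 0 ->
  \sum_z chi (kap z) * (delta (B v z) * delta (B w z)) = 0.
Proof.
move=> v0 w0.
have one u : kap u = 0 -> \sum_z delta (B u z) * chi (kap z) = 0.
  move=> u0; have := sum_singular_delta (phi := fun=> 1) (sum_chi K F_odd) u0.
  under eq_bigr do rewrite mul1r; move=> -> //.
  by under eq_bigr do rewrite mul1r; rewrite sum_chi_kap mulr0.
have [Bvw|Bvw] := eqVneq (B w v) 0.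
  under eq_bigr do rewrite mulrC -mulrA.
  rewrite (sum_singular_delta (sum_chi K F_odd) v0) ?one ?mulr0 // => z t.
  by rewrite BDr BZr Bvw mulr0 addr0.
transitivity (q * \sum_z (B v z == 0)%:R * (chi (kap z) * delta (B w z))
              - \sum_z delta (B w z) * chi (kap z)).
  rewrite mulr_sumr -sumrB; apply: eq_bigr => z _.
  by rewrite {1}/delta; ring.
rewrite one // subr0 (sum_average _ v) big1 ?mulr0 // => z _.
have [Bz|Bz] := eqVneq (B v z) 0; last first.
  rewrite big1 // => t _.
  by rewrite BDr BZr Bxx v0 2!mulr0 addr0 (negPf Bz) mul0r.
rewrite (eq_bigr (fun t => chi (kap z) * delta (B w z + t * B w v))).
  by rewrite -mulr_sumr sum_affine // sum_delta mulr0.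
move=> t _; rewrite [B v _]BDr BZr Bxx v0 2!mulr0 Bz addr0 eqxx mul1r.
by rewrite kapD kapZ v0 mulr0 addr0 BZr B_sym Bz mulr0 addr0 BDr BZr.
Qed.


Lemma gram_sym x y : gram x y = gram y x.
Proof. by apply: eq_bigr => v _; rewrite mulrC. Qed.

Lemma gramZr x y l : l != 0 -> gram x (l *: y) = gram x y.
Proof. by move=> l0; apply: eq_bigr => v _; rewrite BZl deltaM. Qed.

Lemma discZr x y l : disc x (l *: y) = l ^+ 2 * disc x y.
Proof. by rewrite /disc BZr kapZ; ring. Qed.

Lemma parallelZr x y l : l != 0 -> parallel x (l *: y) = parallel x y.
Proof.
move=> l0; rewrite /parallel [RHS](reindex (fun k => k * l)) /=; last first.
  by exists (fun k => k / l) => k _; rewrite ?mulfK ?mulfVK.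
apply: eq_big => [k|k _]; last by rewrite scalerA.
by rewrite mulf_eq0 (negPf l0) orbF.
Qed.

Lemma parallel_disc x y : disc x y != 0 -> parallel x y = 0.
Proof.
move=> d0; apply: big1 => l _; case: eqP => // /eqP.
rewrite addr_eq0 => /eqP xE; move: d0.
rewrite xE -scaleNr disc_sym discZr /disc Bxx => /eqP[]; ring.
Qed.

(** * Tangent lines through an anisotropic point *)

Local Notation tangent_vector x u := ((kap u == 0) && (B x u == 0)).

(** The quotient is the scalar [l] in [z = l *: (x + u)] below. Were [B x z = 0], the discriminant
    would be [- (4 * kap z * kap x)], which is non-zero. *)
Lemma tangent_vectorP x z : kap x != 0 -> kap z != 0 -> disc x z = 0 ->
  B x z / (2 * kap x) != 0.
Proof.
move=> x0 z0 d0.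
have two0 := two_neq0 F_odd.
rewrite mulf_neq0 ?invr_eq0 ?mulf_neq0 //.
apply: contraNneq (mulf_neq0 (mulf_neq0 (mulf_neq0 two0 two0) z0) x0) => Bxz.
by rewrite -oppr_eq0 -[X in _ == X]d0 /disc Bxz; apply/eqP; ring.
Qed.

(* Every z on a tangent through x can be rescaled, uniquely, to x + u with u
   singular and orthogonal to x. *)
Lemma sum_tangent (phi : V -> K) x : kap x != 0 ->
    (forall l z, l != 0 -> phi (l *: z) = phi z) ->
  \sum_(z | kap z != 0) (disc x z == 0)%:R * phi z =
  (q - 1) * \sum_(u | tangent_vector x u) phi (x + u).
Proof.
move=> x0 phiZ; have two0 := two_neq0 F_odd.
have d0 : 2 * kap x != 0 by rewrite mulf_neq0.
rewrite (eq_bigr (fun z => if disc x z == 0 then phi z else 0)); last first.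
  by move=> z _; case: eqP; rewrite ?mul1r ?mul0r.
rewrite -big_mkcondr /= -sum_const_neq0.
(* Sorting by the scalar [l], recovered from [B x (x + u) = 2 * kap x], leaves a copy of the tangent
   vectors for each [l]. *)
rewrite (partition_big (fun z => B x z / (2 * kap x)) (fun l => l != 0)) /=.
  apply: eq_bigr => l l0.
  rewrite (reindex (fun u => l *: (x + u))) /=.
    apply: eq_big => [u|u _]; last by rewrite phiZ.
    rewrite BZr BDr Bxx -[_ / _ == l]subr_eq0 kapZ discZr /disc kapD BDr Bxx.
    rewrite ![l ^+ 2 * _ == 0]mulf_eq0 expf_eq0 (negPf l0) /=.
    have -> : (l * (2 * kap x + B x u) / (2 * kap x) - l == 0) = (B x u == 0).
      have -> : l * (2 * kap x + B x u) / (2 * kap x) - l = l / (2 * kap x) * B x u.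
        by field; rewrite x0 two0.
      by rewrite mulf_eq0 mulf_eq0 invr_eq0 (negPf l0) (negPf d0).
    have [->|_] := eqVneq (B x u) 0; last by rewrite !andbF.
    rewrite !addr0 !andbT.
    have -> : (2 * kap x) ^+ 2 - 4 * (kap x + kap u) * kap x =
              - (2 * 2 * kap x) * kap u by ring.
    rewrite mulf_eq0 oppr_eq0 !mulf_eq0 (negPf two0) (negPf x0) /=.
    by have [->|_] := eqVneq (kap u) 0; rewrite ?addr0 ?x0 ?andbF.
  exists (fun z => l^-1 *: z - x) => z _.
    by rewrite scalerA mulVf // scale1r addrC addKr.
  by rewrite addrC subrK scalerA divff // scale1r.
by move=> z /andP[z0 /eqP dz]; apply: tangent_vectorP.
Qed.

Lemma sum_tangent_vector (phi : V -> K) x : \sum_(u | tangent_vector x u) phi u =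
  (\sum_(u | kap u == 0) phi u + \sum_(u | kap u == 0) delta (B x u) * phi u) / q.
Proof.
rewrite -big_split /= mulr_suml big_mkcondr /=; apply: eq_bigr => u _.
rewrite -[in RHS](mul1r (phi u)) mulrA mulr1 -mulrDl mulrAC -indicatorE.
by case: eqP; rewrite ?mul1r ?mul0r.
Qed.

Lemma sum_tangent_vector_B x y : \sum_(u | tangent_vector x u) delta (B u y) =
  (\sum_(u | kap u == 0) delta (B y u) + gram x y) / q.
Proof.
by rewrite sum_tangent_vector; congr ((_ + _) / _); apply: eq_bigr => u _;
  rewrite (B_sym u).
Qed.

Lemma card_tangent_vector x : kap x != 0 ->
  \sum_(u | tangent_vector x u) 1 = X ^+ 2.
Proof.
move=> x0; rewrite sum_tangent_vector card_singular.
under [X in _ + X]eq_bigr do rewrite mulr1.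
rewrite sum_singular_B delta_neq0 // card_V.
have -> : (x == 0) = false.
  by apply: contraNF x0 => /eqP->; rewrite kap0.
by rewrite mul0r; field; exact: q0.
Qed.

(** Tangent vectors are permuted by non-zero scalars; averaging over these and applying [delta_mul]
    separates [c] from [B u p]. *)
Lemma sum_tangent_vector_shift x p c :
  \sum_(u | tangent_vector x u) delta (c + B u p) =
  delta c / (q - 1) * \sum_(u | tangent_vector x u) delta (B u p).
Proof.
apply: (mulfI q_sub1_neq0).
rewrite mulrA (mulrC (q - 1) (_ / _)) divfK ?q_sub1_neq0 // [RHS]mulr_sumr.
under [RHS]eq_bigr do rewrite delta_mul.
rewrite exchange_big /= -sum_const_neq0; apply: eq_bigr => l l0.
rewrite (reindex (fun u => l *: u)) /=; last first.
  by exists (fun u => l^-1 *: u) => u _; rewrite scalerA ?divff ?mulVf ?scale1r.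
apply: eq_big => [u|u _]; last by rewrite BZl.
by rewrite kapZ BZr mulf_eq0 [_ * B _ _ == 0]mulf_eq0 expf_eq0 (negPf l0).
Qed.

(** Gives [S W] column by column: a multiple of the column plus a constant, with a correction at
    [p = 0]. *)
Lemma tangent_incidence x p : kap x != 0 -> kap p = 0 ->
  \sum_(u | tangent_vector x u) delta (B (x + u) p) =
  (p == 0)%:R * ((q - 1) * X ^+ 2) + e * X * (delta (B x p) - (q - 1)) / q.
Proof.
move=> x0 p0; under eq_bigr do rewrite BDl.
rewrite sum_tangent_vector_shift.
have [->|pn0] := eqVneq p 0.
  under eq_bigr do rewrite B0r delta0 -[q - 1]mulr1.
  rewrite B0r delta0 -mulr_sumr card_tangent_vector // divff ?q_sub1_neq0 //.
  by rewrite !mul1r subrr mulr0 mul0r addr0.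
rewrite sum_tangent_vector_B sum_singular_B (negPf pn0) gram_mixed // p0 delta0 !mul0r.
have [->|Bxp] := eqVneq (B x p) 0.
  by rewrite delta0; field; rewrite q0 q_sub1_neq0.
by rewrite delta_neq0 //; field; rewrite q0 q_sub1_neq0.
Qed.

(** At most one of two distinct elements is 0, so the indicator of a vanishing product is the sum of
    two indicators. *)
Lemma indicator_mul a b : a != b ->
  (a * b == 0)%:R = q^-1 * (2 + delta a + delta b).
Proof.
rewrite mulf_eq0; have [->|a0] := eqVneq a 0; last first.
  by move=> _; rewrite (delta_neq0 K a0) /delta; field; exact: q0.
by rewrite eq_sym => b0; rewrite delta0 (delta_neq0 K b0) [LHS](_ : _ = 1) //; field; exact: q0.
Qed.

(** As [kap (x + u) = kap x = kap y], the discriminant is a difference of squares whose factors are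
    affine in [B u y], and [sum_tangent_vector_shift] evaluates each of them. *)
Lemma tangent2 x y : kap x != 0 -> kap y = kap x ->
  \sum_(u | tangent_vector x u) (disc (x + u) y == 0)%:R =
  2 * X ^+ 2 / q - 2 * (e * X) / q * chi (disc x y)
  + parallel x y * (X ^+ 2 - 2 * X ^+ 2 / q).
Proof.
move=> x0 yx; have two0 := two_neq0 F_odd.
(* The two factors differ by [4 * kap x], so they never vanish together. *)
have d2 : B x y + 2 * kap x - (B x y - 2 * kap x) != 0.
  rewrite (_ : _ - _ = 2 * 2 * kap x); last by ring.
  by rewrite !mulf_neq0.
have Ed : disc x y = (B x y - 2 * kap x) * (B x y + 2 * kap x).
  by rewrite /disc yx; ring.
rewrite (eq_bigr (fun u => q^-1 * (2 + delta (B x y - 2 * kap x + B u y) +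
                                   delta (B x y + 2 * kap x + B u y)))); last first.
  move=> u /andP[/eqP u0 /eqP xu].
  have -> : disc (x + u) y = (B x y - 2 * kap x + B u y) * (B x y + 2 * kap x + B u y).
    by rewrite /disc kapD u0 xu yx BDl; ring.
  by rewrite indicator_mul //; apply: contraNneq d2 => /addIr->; rewrite subrr.
rewrite -mulr_sumr big_split /= big_split /= !sum_tangent_vector_shift.
have -> : \sum_(u | tangent_vector x u) 2 = 2 * X ^+ 2.
  by rewrite -(card_tangent_vector x0) mulr_sumr; under [RHS]eq_bigr do rewrite mulr1.
have -> : \sum_(u | tangent_vector x u) delta (B u y) =
          (q - 1) * (e * X) * (chi (disc x y) + e * X * parallel x y).
  rewrite sum_tangent_vector_B sum_singular_B gram_anisotropic ?yx //.
  have -> : (y == 0) = false.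
    by apply: contraNF x0 => /eqP y0; rewrite -yx y0 kap0.
  by rewrite (delta_neq0 K x0) mul0r; field; exact: q0.
have [d0|d0] := eqVneq (disc x y) 0; last first.
  rewrite (parallel_disc d0); move: d0; rewrite Ed mulf_eq0 negb_or => /andP[d3 d4].
  by rewrite !delta_neq0 //; field; rewrite q0 q_sub1_neq0.
(* Exactly one of the two constants vanishes, so the two values of [delta] are [q - 1] and -1. *)
have dE : delta (B x y - 2 * kap x) + delta (B x y + 2 * kap x) = q - 2.
  move/eqP: d0; rewrite Ed mulf_eq0 => /orP[] /eqP d0; rewrite d0 delta0.
    rewrite delta_neq0; first by ring.
    by rewrite d0 subr0 in d2.
  rewrite delta_neq0; first by ring.
  by rewrite d0 sub0r oppr_eq0 in d2.
rewrite d0 chi0 mulr0 subr0 add0r.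
transitivity ((2 * X ^+ 2 + (delta (B x y - 2 * kap x) + delta (B x y + 2 * kap x))
                * (e * e) * X ^+ 2 * parallel x y) / q).
  by field; rewrite q0 q_sub1_neq0.
by rewrite dE e_sqr; field; exact: q0.
Qed.


(** * Matrices indexed by the anisotropic points *)

Variables (pt : finType) (rep : pt -> V).
Hypothesis rep_neq0 : forall i, kap (rep i) != 0.
(** Each point carries [q - 1] vectors; this turns the sums over vectors computed above into sums
    over points. *)
Hypothesis sum_rep : forall phi : V -> K,
  (forall l z, l != 0 -> phi (l *: z) = phi z) ->
  \sum_(v | kap v != 0) phi v = (q - 1) * \sum_i phi (rep i).
Hypothesis rep_parallel : forall i j, parallel (rep i) (rep j) = (i == j)%:R.

Lemma X_neq0 : X != 0.
Proof.
suff: (q * X) ^+ 2 != 0 by rewrite expf_eq0 mulf_eq0 /= negb_or => /andP[].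
by rewrite -card_V pnatr_eq0 -lt0n; apply/card_gt0P; exists 0.
Qed.

Lemma q_add1_neq0 : q + 1 != 0.
Proof. by rewrite natr1 pnatr_eq0. Qed.

Lemma e_neq0 : e != 0.
Proof. by apply: contra_eq_neq e_sqr => ->; rewrite mul0r eq_sym oner_neq0. Qed.

Lemma q_sqr_sub1_neq0 : q ^+ 2 - 1 != 0.
Proof.
rewrite (_ : q ^+ 2 - 1 = (q - 1) * (q + 1)); last by ring.
by rewrite mulf_neq0 ?q_sub1_neq0 ?q_add1_neq0.
Qed.

(* The projection onto V_0 + V_2, a multiple of W W^T for the incidence matrix W
   between anisotropic points and singular vectors. *)
Definition proj i j : K :=
  gram (rep i) (rep j) / ((q - 1) ^+ 2 * (q + 1) * X ^+ 2).
(* The adjacency matrix of the union of R_0 and R_1. *)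
Definition tangent i j : K := (disc (rep i) (rep j) == 0)%:R.
Definition type_sign i : K := chi (kap (rep i)).

Lemma proj_denom_neq0 : (q - 1) ^+ 2 * (q + 1) * X ^+ 2 != 0.
Proof.
by rewrite !mulf_neq0 ?expf_neq0 ?q_sub1_neq0 ?q_add1_neq0 ?X_neq0.
Qed.

Lemma proj_sym i j : proj i j = proj j i.
Proof. by rewrite /proj gram_sym. Qed.

Lemma tangent_sym i j : tangent i j = tangent j i.
Proof. by rewrite /tangent disc_sym. Qed.

Lemma type_sign_sqr i : type_sign i * type_sign i = 1.
Proof. exact: chi_sqr1. Qed.

Lemma projE i j : proj i j =
  e * (1 + q * chi (disc (rep i) (rep j)) + e * q * X * (i == j)%:R)
  / (X * (q ^+ 2 - 1)).
Proof.
rewrite /proj gram_anisotropic // rep_parallel.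
rewrite (_ : q ^+ 2 - 1 = (q - 1) * (q + 1)); last by ring.
by field; rewrite q_sub1_neq0 q_add1_neq0 X_neq0.
Qed.

Lemma sum_rep_div (phi : V -> K) : (forall l z, l != 0 -> phi (l *: z) = phi z) ->
  \sum_i phi (rep i) = (\sum_(v | kap v != 0) phi v) / (q - 1).
Proof. by move=> phiZ; rewrite sum_rep // mulrAC divff ?mul1r ?q_sub1_neq0. Qed.

Lemma card_pt : #|pt|%:R = X * (X * q - e).
Proof.
have := sum_rep_div (phi := fun=> 1) (fun _ _ _ => erefl).
rewrite sum_const_type mulr1 => ->.
rewrite sum_anisotropic card_singular sum_const_type mulr1 card_V.
by field; rewrite q0 q_sub1_neq0.
Qed.

Lemma gram_incidence_rep i w : kap w = 0 ->
  \sum_k gram (rep i) (rep k) * delta (B (rep k) w) =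
  (q - 1) ^+ 2 * (q + 1) * X ^+ 2 * delta (B (rep i) w).
Proof.
move=> w0; rewrite (sum_rep_div (phi := fun z => gram _ z * delta (B z w))).
  by rewrite gram_incidence //; field; exact: q_sub1_neq0.
by move=> l z l0; rewrite gramZr // BZl deltaM.
Qed.

(** Once one factor is written as a sum over singular [w], the other acts on the incidences with [w]
    as a scalar, by [gram_incidence_rep]. *)
Lemma proj_proj i j : \sum_k proj i k * proj k j = proj i j.
Proof.
have d0 := proj_denom_neq0; set d := (_ * _ * _) in d0.
have -> : \sum_k proj i k * proj k j =
    (\sum_(w | kap w == 0) delta (B (rep j) w) *
       \sum_k gram (rep i) (rep k) * delta (B (rep k) w)) / d / d.
  rewrite -!mulrA mulr_suml; under [RHS]eq_bigr do rewrite mulr_sumr mulr_suml.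
  rewrite exchange_big /=; apply: eq_bigr => k _.
  rewrite /proj -/d {2}/gram mulrACA -invfM mulr_sumr mulr_suml.
  by apply: eq_bigr => w _; rewrite invfM; ring.
rewrite (eq_bigr (fun w => d * (delta (B (rep i) w) * delta (B (rep j) w)))).
  by rewrite -mulr_sumr /proj -/d /gram; field; exact: d0.
by move=> w /eqP w0; rewrite gram_incidence_rep // -/d mulrCA [delta _ * _]mulrC.
Qed.

(** The incidence column of the singular vector 0 is constant, so this is [gram_incidence_rep] at
    [w = 0]. *)
Lemma proj_one i : \sum_k proj i k = 1.
Proof.
have := gram_incidence_rep i kap0.
under eq_bigr do rewrite B0r; rewrite B0r -mulr_suml delta0.
move=> /(mulIf q_sub1_neq0) E1.
by rewrite -mulr_suml E1 divff ?proj_denom_neq0.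
Qed.

(** Expanding both projections over singular vectors leaves the sums of [chi_incidence]; restricting
    them to anisotropic vectors changes nothing since [chi 0 = 0]. *)
Lemma proj_sign_proj i j : \sum_k proj i k * type_sign k * proj k j = 0.
Proof.
set d := ((q - 1) ^+ 2 * (q + 1) * X ^+ 2).
have -> : \sum_k proj i k * type_sign k * proj k j =
    \sum_(v | kap v == 0) \sum_(w | kap w == 0)
      delta (B (rep i) v) * delta (B (rep j) w) / d / d *
       \sum_k type_sign k * (delta (B v (rep k)) * delta (B w (rep k))).
  under [RHS]eq_bigr do under eq_bigr do rewrite mulr_sumr.
  under [RHS]eq_bigr do rewrite exchange_big /=.
  rewrite exchange_big /=; apply: eq_bigr => k _.
  rewrite /proj /gram -/d !mulr_suml; apply: eq_bigr => v _.
  rewrite mulr_sumr; apply: eq_bigr => w _.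
  by rewrite !(B_sym _ (rep k)); ring.
apply: big1 => v /eqP v0; apply: big1 => w /eqP w0.
rewrite (sum_rep_div (phi := fun z => chi (kap z) * (delta (B v z) * delta (B w z)))).
  rewrite sum_anisotropic chi_incidence // big1 ?subrr ?mul0r ?mulr0 //.
  by move=> z /eqP z0; rewrite z0 chi0 mul0r.
by move=> l z l0; rewrite kapZ chi_sqrM // !BZr !deltaM.
Qed.

(** On a tangent line the values of [kap] at two anisotropic points differ by a square factor, as
    the vanishing discriminant shows. *)
Lemma tangent_sign i j : tangent i j * type_sign j = type_sign i * tangent i j.
Proof.
rewrite /tangent; case: eqP => [dij|_]; last by rewrite mul0r mulr0.
rewrite mul1r mulr1 /type_sign.
have kE : kap (rep j) = (B (rep i) (rep j) / (2 * kap (rep i))) ^+ 2 * kap (rep i).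
  have -> : kap (rep j) = (B (rep i) (rep j) ^+ 2 - disc (rep i) (rep j)) / (4 * kap (rep i)).
    rewrite /disc; field; rewrite rep_neq0.
    by rewrite (_ : 4 = 2 * 2) ?mulf_neq0 ?two_neq0 //; ring.
  rewrite dij; field; rewrite rep_neq0.
  by rewrite (_ : 4 = 2 * 2) ?mulf_neq0 ?two_neq0 //; ring.
by rewrite kE chi_sqrM // tangent_vectorP.
Qed.

Lemma sum_tangent_rep (phi : V -> K) i :
    (forall l z, l != 0 -> phi (l *: z) = phi z) ->
  \sum_k tangent i k * phi (rep k) = \sum_(u | tangent_vector (rep i) u) phi (rep i + u).
Proof.
move=> phiZ; rewrite (sum_rep_div (phi := fun z => (disc (rep i) z == 0)%:R * phi z)).
  by rewrite sum_tangent // mulrAC divff ?mul1r ?q_sub1_neq0.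
by move=> l z l0; rewrite discZr mulf_eq0 expf_eq0 (negPf l0) phiZ.
Qed.

Lemma tangent_proj i j :
  \sum_k tangent i k * proj k j = e * X / q * proj i j + q^-1.
Proof.
have d0 := proj_denom_neq0; set d := (_ * _ * _) in d0.
have -> : \sum_k tangent i k * proj k j =
    (\sum_(w | kap w == 0) delta (B (rep j) w) *
       \sum_k tangent i k * delta (B (rep k) w)) / d.
  rewrite mulr_suml; under [RHS]eq_bigr do rewrite mulr_sumr mulr_suml.
  rewrite exchange_big /=; apply: eq_bigr => k _.
  rewrite /proj -/d /gram mulrA mulr_sumr mulr_suml.
  by apply: eq_bigr => w _; ring.
rewrite (eq_bigr (fun w => e * X / q * (delta (B (rep i) w) * delta (B (rep j) w)) +
   (if w == 0 then (q - 1) ^+ 2 * X ^+ 2 else 0) +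
   - (e * X * (q - 1) / q) * delta (B (rep j) w))); last first.
  move=> w /eqP w0; rewrite (sum_tangent_rep (phi := fun z => delta (B z w))).
    rewrite tangent_incidence //; have [->|_] := eqVneq w 0.
      by rewrite !B0r delta0 mul1r; field; exact: q0.
    by rewrite mul0r; field; exact: q0.
  by move=> l z l0; rewrite BZl deltaM.
rewrite big_split big_split /= -!mulr_sumr -big_mkcondr /=.
rewrite [X in _ + X + _](big_pred1 0); last first.
  by move=> w /=; have [->|_] := eqVneq w 0; rewrite ?kap0 ?eqxx ?andbF.
rewrite sum_singular_B (delta_neq0 K (rep_neq0 j)).
have -> : (rep j == 0) = false.
  by apply: contraNF (rep_neq0 j) => /eqP->; rewrite kap0.
rewrite -/(gram (rep i) (rep j)) mul0r add0r /proj -/d.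
have -> : - (e * X * (q - 1) / q) * (E * -1 / q) = (e * e) * (X * (q - 1)) ^+ 2 / q.
  by field; exact: q0.
(* The zero vector contributes [(q - 1) ^+ 2 * X ^+ 2] and the constant part [1 / q] times that,
   together [d / q]. *)
rewrite e_sqr -[in RHS](mulfK d0 q^-1) /d.
by field; rewrite q0 X_neq0 q_add1_neq0 q_sub1_neq0.
Qed.

(** A common neighbour in [tangent] has the type of both points, so points of different types
    contribute nothing. For equal types, [rep j] is rescaled to make the values of [kap] agree, and
    [tangent2] applies. *)
Lemma tangent_tangent i j : \sum_k tangent i k * tangent k j =
  X ^+ 2 * (i == j)%:R
  + (1 + type_sign i * type_sign j) * (X ^+ 2 / q + e * X / q ^+ 2
       - X ^+ 2 * (1 - (q ^+ 2)^-1) * proj i j).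
Proof.
have [sij|sij] := eqVneq (type_sign i) (type_sign j); last first.
  have -> : type_sign i * type_sign j = -1.
    move: sij; rewrite /type_sign.
    by have [->|->] := chi_neq0 K (rep_neq0 i); have [->|->] := chi_neq0 K (rep_neq0 j);
      rewrite ?eqxx ?mulr1 ?mul1r.
  rewrite subrr mul0r addr0 big1.
    have -> : (i == j) = false by apply: contraNF sij => /eqP->.
    by rewrite mulr0.
  move=> k _; apply/eqP; rewrite mulf_eq0; apply: contraNT sij.
  rewrite negb_or => /andP[tik tkj]; apply/eqP.
  transitivity (type_sign k).
    by apply: (mulIf tik); rewrite -tangent_sign mulrC.
  by apply: (mulIf tkj); rewrite -tangent_sign mulrC.
rewrite -sij type_sign_sqr.
rewrite (sum_tangent_rep (phi := fun z => (disc z (rep j) == 0)%:R)); last first.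
  by move=> l z l0; rewrite disc_sym discZr mulf_eq0 expf_eq0 (negPf l0) disc_sym.
have [l l0 ij] := chi_eq_ratio F_odd (rep_neq0 j) (rep_neq0 i) (esym sij).
rewrite (eq_bigr (fun u => (disc (rep i + u) (l *: rep j) == 0)%:R)); last first.
  by move=> u _; rewrite discZr mulf_eq0 expf_eq0 (negPf l0).
rewrite tangent2 //; last by rewrite kapZ ij.
rewrite discZr chi_sqrM // parallelZr // rep_parallel projE.
(* [projE] brings a factor [e * e] into the right-hand side; inserting it on the left too makes both
   sides the same rational function. *)
have -> : X ^+ 2 - 2 * X ^+ 2 / q = X ^+ 2 - 2 * (e * e) * X ^+ 2 / q.
  by rewrite e_sqr mulr1.
by field; rewrite q0 X_neq0 q_sqr_sub1_neq0.
Qed.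

End QuadraticSpace.

(** * Association schemes from orthogonal idempotents *)

Section SchemeFromIdempotents.

Variables (K : realType) (T : finType) (d : nat).
Variables (Rel : 'I_d.+1 -> rel T) (E : 'I_d.+1 -> 'M[K]_#|T|) (P Q : 'M[K]_d.+1).

Local Notation A i := (adjmx K (Rel i)).
Local Notation n := (#|T|%:R : K).

Hypothesis Rel_partition : forall x y, exists! i, Rel i x y.
Hypothesis Rel_sym : forall i, symmetric (Rel i).
Hypothesis Rel0 : forall x y, Rel ord0 x y = (x == y).
Hypothesis T_gt0 : (0 < #|T|)%N.
Hypothesis valency_neq0 : forall i, P ord0 i != 0.
Hypothesis PQ : P *m Q = n%:M.
Hypothesis Q_col0 : forall i, Q i ord0 = 1.
Hypothesis E_ortho : forall i j, E i *m E j = if i == j then E i else 0.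
Hypothesis E_def : forall j, E j = n^-1 *: \sum_i Q i j *: A i.

Let n_neq0 : n != 0. Proof. by rewrite pnatr_eq0 -lt0n. Qed.

Let P_invQ : P *m (n^-1 *: Q) = 1%:M.
Proof. by rewrite -scalemxAr PQ scale_scalar_mx mulVf. Qed.

Let P_unit : P \in unitmx. Proof. by have [] := mulmx1_unit P_invQ. Qed.

Lemma dual_from_product : dual_eigenmatrix T P Q.
Proof.
split=> //; apply: (can_inj (mulKmx P_unit)).
by rewrite PQ -scalemxAr mulmxV // scale_scalar_mx mulr1.
Qed.

Let QP : Q *m P = n%:M.
Proof.
have := mulmx1C P_invQ; rewrite -scalemxAl => /(congr1 ( *:%R n)).
by rewrite scalerA divff // scale1r scale_scalar_mx mulr1.
Qed.

Lemma adjmx_spectral i : A i = \sum_j P j i *: E j.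
Proof.
under eq_bigr do rewrite E_def scalerA mulrC -scalerA scaler_sumr.
rewrite -scaler_sumr exchange_big /=.
rewrite (eq_bigr (fun k => (n *+ (k == i)) *: A k)) => [|k _].
  rewrite (bigD1 i) //= eqxx big1 => [|k /negPf->]; last by rewrite scale0r.
  by rewrite addr0 mulr1n scalerA mulVf // scale1r.
transitivity ((Q *m P) k i *: A k); last by rewrite QP mxE.
by rewrite mxE scaler_suml; apply: eq_bigr => j _; rewrite scalerA mulrC.
Qed.

Lemma adjmx_ent i x y : A i (enum_rank x) (enum_rank y) = (Rel i x y)%:R.
Proof. by rewrite mxE !enum_rankK. Qed.

Lemma comb_adjmx_ent (c : 'I_d.+1 -> K) k x y : Rel k x y ->
  (\sum_i c i *: A i) (enum_rank x) (enum_rank y) = c k.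
Proof.
move=> kxy; rewrite summxE (bigD1 k) //= mxE adjmx_ent kxy mulr1 big1 ?addr0 //.
move=> i ik; rewrite mxE adjmx_ent; case: (boolP (Rel i x y)) => [ixy|]; last by rewrite mulr0.
have [k' [_ k'_uniq]] := Rel_partition x y.
by move: ik; rewrite -(k'_uniq i) // (k'_uniq k) // eqxx.
Qed.

Lemma idempotent0 : E ord0 = n^-1 *: const_mx 1.
Proof.
rewrite E_def; congr (_ *: _); apply/matrixP => x y.
rewrite -(enum_valK x) -(enum_valK y) [RHS]mxE.
have [k [kxy _]] := Rel_partition (enum_val x) (enum_val y).
by rewrite (comb_adjmx_ent _ kxy) Q_col0.
Qed.

Lemma adjmx_idempotent i j : A i *m E j = P j i *: E j.
Proof.
rewrite adjmx_spectral mulmx_suml (bigD1 j) //= -scalemxAl E_ortho eqxx.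
by rewrite big1 ?addr0 // => k /negPf kj; rewrite -scalemxAl E_ortho kj scaler0.
Qed.

Lemma idempotent0_neq0 : E ord0 != 0.
Proof.
have [x _] := card_gt0P T_gt0.
apply/eqP => /matrixP /(_ (enum_rank x) (enum_rank x)) /eqP.
by rewrite idempotent0 !mxE mulr1 invr_eq0 (negPf n_neq0).
Qed.

(** [A i] has the non-zero eigenvalue [P ord0 i] on [E ord0], so it is not the zero matrix. *)
Lemma Rel_nonempty i : exists x y, Rel i x y.
Proof.
suff /matrix0Pn[x [y]] : A i != 0.
  by rewrite mxE pnatr_eq0 eqb0 negbK; exists (enum_val x), (enum_val y).
apply: contraNneq idempotent0_neq0 => Ai0.
have /eqP := adjmx_idempotent i ord0.
by rewrite Ai0 mul0mx eq_sym scaler_eq0 (negPf (valency_neq0 i)).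
Qed.

(** If [E j] vanished, so would column [j] of [Q], all relations being non-empty; this contradicts
    the diagonal of [PQ]. *)
Lemma idempotent_neq0 j : E j != 0.
Proof.
apply/eqP => Ej0; have /matrixP /(_ j j) /eqP := PQ.
rewrite !mxE big1 ?eqxx ?mulr1n 1?eq_sym ?(negPf n_neq0) // => i _.
have [x [y ixy]] := Rel_nonempty i.
suff -> : Q i j = 0 by rewrite mulr0.
have /matrixP /(_ (enum_rank x) (enum_rank y)) /eqP := E_def j.
rewrite Ej0 mxE mxE (comb_adjmx_ent _ ixy) eq_sym mulf_eq0 invr_eq0.
by rewrite (negPf n_neq0) => /eqP.
Qed.

Lemma intersection_number i j k : exists p : nat,
  forall x y, Rel k x y -> #|[set z | Rel i x z && Rel j y z]| = p.
Proof.
(* The coefficients of [A i *m A j], found by multiplying the eigenvalues on each [E h] and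
   expanding [E h] in the adjacency matrices. *)
pose c l := n^-1 * \sum_h P h i * P h j * Q l h.
have AA : A i *m A j = \sum_l c l *: A l.
  rewrite [A j]adjmx_spectral mulmx_sumr.
  under eq_bigr do rewrite -scalemxAr adjmx_idempotent scalerA E_def scalerA mulrC
    -scalerA scaler_sumr.
  rewrite -scaler_sumr exchange_big scaler_sumr; apply: eq_bigr => l _.
  rewrite -scalerA scaler_suml; congr (_ *: _); apply: eq_bigr => h _.
  by rewrite scalerA [P h j * _]mulrC.
have cE x y : Rel k x y -> #|[set z | Rel i x z && Rel j y z]|%:R = c k.
  move=> kxy; rewrite -(comb_adjmx_ent c kxy) -AA mxE -sum1_card natr_sum.
  rewrite big_mkcond /= (reindex (@enum_val T predT)) /=; last exact/onW_bij/enum_val_bij.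
  apply: eq_bigr => z _; rewrite inE !mxE !enum_rankK.
  by rewrite [Rel j _ (enum_val z)]Rel_sym; do 2 case: (Rel _ _ _); rewrite ?mulr1 ?mulr0.
have [x [y kxy]] := Rel_nonempty k.
exists #|[set z | Rel i x z && Rel j y z]| => x' y' kxy'.
by apply/eqP; rewrite -(eqr_nat K) !cE.
Qed.

Lemma idempotents_basis : basis_of (bose_mesner K Rel) [seq E j | j : 'I_d.+1].
Proof.
rewrite basisEfree; apply/and3P; split.
- pose t := codom_tuple E; rewrite -[X in free X]/(val t).
  apply/freeP => c cE i.
  have /eqP := congr1 (mulmxr (E (enum_val i))) cE.
  rewrite /= mul0mx mulmx_suml (bigD1 i) //= nth_codom -scalemxAl E_ortho eqxx.
  rewrite big1 ?addr0 => [|k ki].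
    by rewrite scaler_eq0 (negPf (idempotent_neq0 _)) orbF => /eqP.
  by rewrite nth_codom -scalemxAl E_ortho (inj_eq enum_val_inj) (negPf ki) scaler0.
- apply/span_subvP => _ /imageP[j _ ->]; rewrite E_def memvZ // memv_suml // => i _.
  by rewrite memvZ // memv_span // image_f.
(* The span of [d + 1] matrices has dimension at most [d + 1], the number of idempotents. *)
- by rewrite (leq_trans (dim_span _)) // !size_image.
Qed.

Theorem scheme_from_idempotents : scheme_with_eigenmatrices Rel P Q.
Proof.
split; first by split=> //; [exact: Rel_nonempty | exact: intersection_number].
exists E; split; last exact: dual_from_product.
- by split; [exact: idempotents_basis | exact: E_ortho | exact: idempotent0].
- exact: adjmx_idempotent.
Qed.

End SchemeFromIdempotents.

(** * Six orthogonal idempotents from the relations between [J], [D], [M] and [S] *)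

Section IdempotentAlgebra.

Variables (K : realType) (N : nat) (J D M S : 'M[K]_N) (c x q e : K).
Hypotheses (c_neq0 : c != 0) (x_neq0 : x != 0) (e_sqr : e * e = 1).
Hypotheses (JJ : J *m J = c *: J) (MM : M *m M = M) (JM : J *m M = J) (MJ : M *m J = J).
Hypotheses (DD : D *m D = 1%:M) (MDM : M *m D *m M = 0).
Hypotheses (SM : S *m M = (e * x / q) *: M + q^-1 *: J).
Hypotheses (MS : M *m S = (e * x / q) *: M + q^-1 *: J).
Hypothesis SD : S *m D = D *m S.
Hypothesis SS : S *m S = (x ^+ 2)%:M
  + (x ^+ 2 / q + e * x / q ^+ 2) *: (J + D *m J *m D)
  - (x ^+ 2 * (1 - (q ^+ 2)^-1)) *: (M + D *m M *m D).

Let e_neq0 : e != 0.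
Proof. by apply: contra_eq_neq e_sqr => ->; rewrite mul0r eq_sym oner_neq0. Qed.

Let J0 := c^-1 *: J.
Let J1 := D *m J0 *m D.
Let M1 := D *m M *m D.
Let C := 1%:M - (M + M1).
Let U := (e / x) *: (S *m C).

(* M projects onto V_0 + V_2 and its conjugate M1 by the signs D onto V_1 + V_3.
   On the remaining space V_4 + V_5, the range of C, the matrix S has square
   x^2, and U = S / (e x) there separates V_4 from V_5. *)
Definition idempotent (j : nat) : 'M[K]_N :=
  nth 0 [:: J0; J1; M - J0; M1 - J1; 2^-1 *: (C + U); 2^-1 *: (C - U)] j.

Let J0J0 : J0 *m J0 = J0.
Proof. by rewrite -scalemxAl -scalemxAr JJ !scalerA mulfVK. Qed.
Let J0M : J0 *m M = J0. Proof. by rewrite -scalemxAl JM. Qed.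
Let MJ0 : M *m J0 = J0. Proof. by rewrite -scalemxAr MJ. Qed.

(** Conjugation by the involution [D] is multiplicative, which transfers identities for [J0] and [M]
    to [J1] and [M1]. *)
Let conjM (A B : 'M[K]_N) : (D *m A *m D) *m (D *m B *m D) = D *m (A *m B) *m D.
Proof. by rewrite -!mulmxA (mulmxA D D) DD mul1mx. Qed.

Let J1J1 : J1 *m J1 = J1. Proof. by rewrite conjM J0J0. Qed.
Let J1M1 : J1 *m M1 = J1. Proof. by rewrite conjM J0M. Qed.
Let M1J1 : M1 *m J1 = J1. Proof. by rewrite conjM MJ0. Qed.
Let M1M1 : M1 *m M1 = M1. Proof. by rewrite conjM MM. Qed.

Let MM1 : M *m M1 = 0. Proof. by rewrite !mulmxA MDM mul0mx. Qed.
Let M1M : M1 *m M = 0. Proof. by rewrite -!mulmxA (mulmxA M) MDM mulmx0. Qed.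
Let J0M1 : J0 *m M1 = 0. Proof. by rewrite -J0M -mulmxA MM1 mulmx0. Qed.
Let M1J0 : M1 *m J0 = 0. Proof. by rewrite -MJ0 mulmxA M1M mul0mx. Qed.
Let MJ1 : M *m J1 = 0. Proof. by rewrite -M1J1 mulmxA MM1 mul0mx. Qed.
Let J1M : J1 *m M = 0. Proof. by rewrite -J1M1 -mulmxA M1M mulmx0. Qed.
Let J0J1 : J0 *m J1 = 0. Proof. by rewrite -M1J1 mulmxA J0M1 mul0mx. Qed.
Let J1J0 : J1 *m J0 = 0. Proof. by rewrite -J1M1 -mulmxA M1J0 mulmx0. Qed.

Let CM : C *m M = 0.
Proof. by rewrite mulmxBl mul1mx mulmxDl MM M1M addr0 subrr. Qed.
Let CM1 : C *m M1 = 0.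
Proof. by rewrite mulmxBl mul1mx mulmxDl M1M1 MM1 add0r subrr. Qed.
Let MC : M *m C = 0.
Proof. by rewrite mulmxBr mulmx1 mulmxDr MM MM1 addr0 subrr. Qed.
Let M1C : M1 *m C = 0.
Proof. by rewrite mulmxBr mulmx1 mulmxDr M1M1 M1M add0r subrr. Qed.
Let CC : C *m C = C.
Proof. by rewrite {2}/C mulmxBr mulmx1 mulmxDr CM CM1 addr0 subr0. Qed.
Let J0C : J0 *m C = 0. Proof. by rewrite -J0M -mulmxA MC mulmx0. Qed.
Let J1C : J1 *m C = 0. Proof. by rewrite -J1M1 -mulmxA M1C mulmx0. Qed.
Let CJ0 : C *m J0 = 0. Proof. by rewrite -MJ0 mulmxA CM mul0mx. Qed.
Let CJ1 : C *m J1 = 0. Proof. by rewrite -M1J1 mulmxA CM1 mul0mx. Qed.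

Let SM_eq_MS : S *m M = M *m S. Proof. by rewrite SM MS. Qed.
Let SM1 : S *m M1 = M1 *m S.
Proof. by rewrite /M1 !mulmxA SD -[D *m S *m M]mulmxA SM_eq_MS -!mulmxA SD. Qed.
Let SC : S *m C = C *m S.
Proof. by rewrite mulmxBr mulmxBl mulmx1 mul1mx mulmxDr mulmxDl SM_eq_MS SM1. Qed.

Let CU : C *m U = U.
Proof. by rewrite -scalemxAr mulmxA -SC -mulmxA CC. Qed.
Let UC : U *m C = U.
Proof. by rewrite -scalemxAl -mulmxA CC. Qed.
Let UU : U *m U = C.
Proof.
rewrite -scalemxAl -scalemxAr scalerA mulmxA -(mulmxA S C S) -SC -!mulmxA CC mulmxA SS.
(* [C] is annihilated by [J], [D J D], [M] and [D M D], so only the scalar part [x ^+ 2] of [SS]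
   survives. *)
have JC : J *m C = 0 by rewrite -MJ -JM -mulmxA -mulmxA MC !mulmx0.
have DJDC : D *m J *m D *m C = 0.
  have -> : D *m J *m D = c *: J1.
    by rewrite /J1 -scalemxAr -scalemxAl scalerA divff // scale1r.
  by rewrite -scalemxAl J1C scaler0.
rewrite mulmxBl mulmxDl -!scalemxAl !mulmxDl JC DJDC MC M1C !addr0 !scaler0 subr0 addr0.
rewrite mul_scalar_mx scalerA -[RHS]scale1r; congr (_ *: _).
by rewrite -e_sqr; field.
Qed.

Let J0U : J0 *m U = 0. Proof. by rewrite -CU mulmxA J0C mul0mx. Qed.
Let J1U : J1 *m U = 0. Proof. by rewrite -CU mulmxA J1C mul0mx. Qed.
Let MU : M *m U = 0. Proof. by rewrite -CU mulmxA MC mul0mx. Qed.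
Let M1U : M1 *m U = 0. Proof. by rewrite -CU mulmxA M1C mul0mx. Qed.
Let UJ0 : U *m J0 = 0. Proof. by rewrite -UC -mulmxA CJ0 mulmx0. Qed.
Let UJ1 : U *m J1 = 0. Proof. by rewrite -UC -mulmxA CJ1 mulmx0. Qed.
Let UM : U *m M = 0. Proof. by rewrite -UC -mulmxA CM mulmx0. Qed.
Let UM1 : U *m M1 = 0. Proof. by rewrite -UC -mulmxA CM1 mulmx0. Qed.

Let half (A : 'M[K]_N) : 2^-1 *: (A + A) = A.
Proof. by rewrite -mulr2n -scaler_nat scalerA mulVf ?scale1r // pnatr_eq0. Qed.

Lemma idempotent_ortho (i j : 'I_6) :
  idempotent i *m idempotent j = if i == j then idempotent i else 0.
Proof.
have table := (J0J0, J0M, MJ0, MM, J1J1, J1M1, M1J1, M1M1, MM1, M1M, J0M1, M1J0, MJ1,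
  J1M, J0J1, J1J0, CM, CM1, MC, M1C, CC, J0C, J1C, CJ0, CJ1, CU, UC, UU, J0U, J1U,
  MU, M1U, UJ0, UJ1, UM, UM1).
(* Abstracting the building blocks keeps their definitions from unfolding; the 36 products then
   follow from bilinearity and the multiplication table. *)
move: table; rewrite /idempotent; move: (J0) (J1) (M1) (C) (U) => j0 j1 m1 c1 u table.
case: i => [[|[|[|[|[|[|//]]]]]] ?]; case: j => [[|[|[|[|[|[|//]]]]]] ?];
  rewrite -[Ordinal _ == _]/(_ == _ :> nat) /= -?scalemxAl -?scalemxAr
    ?(mulmxDl, mulmxDr, mulmxN, mulNmx)
    ?table ?(addr0, add0r, oppr0, opprK, subrr, scaler0) ?[u + c1]addrC
    ?[- u + c1]addrC ?subrr ?scaler0 ?half //.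
  by rewrite addrA subrK subrr !scaler0.
by rewrite addrA addrK subrr !scaler0.
Qed.
End IdempotentAlgebra.

(** * The quadratic form of the quadric *)

Lemma bqfE (F : fieldType) (a b c s t : F) :
  (bqf a b c).[s, t] = a * s ^+ 2 + b * s * t + c * t ^+ 2.
Proof. by rewrite /bqf !hornerE. Qed.

Section BinaryForm.

Variables (K : realFieldType) (F : finFieldType) (a b c : F).
Hypothesis F_odd : odd #|F|.
Hypothesis f_nondeg : bqf_nondegenerate (bqf a b c).

Local Notation q := (#|F|%:R : K).
Local Notation delta := (delta K).
Local Notation chi := (chi K).
Local Notation D := (b ^+ 2 - 4 * a * c).

(** If the discriminant vanishes, [(b, - (2 * a))] lies in the radical; should this vector be 0,
    [(1, 0)] does. *)
Lemma bqf_disc_neq0 : D != 0.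
Proof.
apply/eqP => D0; have [|b0 /eqP] := f_nondeg (x := b) (y := - (2 * a)).
  move=> x y; rewrite !bqfE.
  transitivity (D * y); last by rewrite D0 mul0r.
  by ring.
rewrite oppr_eq0 mulf_eq0 (negPf (two_neq0 F_odd)) => /= /eqP a0.
have [|/eqP] := f_nondeg (x := 1) (y := 0); last by rewrite oner_eq0.
by move=> x y; rewrite !bqfE a0 b0; ring.
Qed.

(** For [a = 0] and [t <> 0] the form is affine in [s] and contributes nothing; for [a <> 0],
    [quadratic_count] evaluates each sum over [s]. *)
Lemma sum_delta_bqf :
  \sum_s \sum_t delta ((bqf a b c).[s, t]) = chi D * q * (q - 1).
Proof.
rewrite exchange_big /= (bigD1 0) //=.
have [a0|a0] := eqVneq a 0.
  have b0 : b != 0.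
    by move: bqf_disc_neq0; rewrite a0 mulr0 mul0r subr0 expf_eq0.
  rewrite a0 mulr0 mul0r subr0 chi_sqr // [X in _ + X]big1 => [|t t0].
    rewrite (eq_bigr (fun=> q - 1)); first by rewrite sum_const_type; ring.
    by move=> s _; rewrite bqfE !mul0r mulr0 expr0n mulr0 !addr0 delta0.
  rewrite (eq_bigr (fun s => delta (c * t ^+ 2 + s * (b * t)))).
    by rewrite sum_affine ?sum_delta // mulf_neq0.
  by move=> s _; rewrite bqfE; congr delta; ring.
have sum_s t : \sum_s delta ((bqf a b c).[s, t]) = q * chi (t ^+ 2 * D).
  rewrite /delta sumrB sum_const_type mulr1 -mulr_sumr.
  rewrite (eq_bigr (fun s => (a * s ^+ 2 + b * t * s + c * t ^+ 2 == 0)%:R)).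
    rewrite quadratic_count // mulrDr mulr1 addrC addKr.
    by congr (_ * chi _); ring.
  by move=> s _; rewrite bqfE mulrAC.
rewrite sum_s expr0n mul0r chi0 mulr0 add0r.
rewrite (eq_bigr (fun=> q * chi D)); last by move=> t t0; rewrite sum_s chi_sqrM.
by rewrite sum_const_neq0; ring.
Qed.

Lemma sum_chi_bqf : \sum_s \sum_t chi ((bqf a b c).[s, t]) = 0.
Proof.
rewrite exchange_big /= (bigD1 0) //=.
have [a0|a0] := eqVneq a 0.
  have b0 : b != 0.
    by move: bqf_disc_neq0; rewrite a0 mulr0 mul0r subr0 expf_eq0.
  rewrite !big1 ?addr0 // => [t t0|s _].
    rewrite (eq_bigr (fun s => chi (c * t ^+ 2 + s * (b * t)))).
      by rewrite sum_affine ?sum_chi // mulf_neq0.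
    by move=> s _; rewrite bqfE a0; congr chi; ring.
  by rewrite bqfE a0 !mul0r mulr0 expr0n mulr0 !addr0 chi0.
have two0 := two_neq0 F_odd.
have a4 : 2 * a != 0 by rewrite mulf_neq0.
(* [4 * a] times the form is [(b * t + s * (2 * a)) ^+ 2 - t ^+ 2 * D], and [chi] ignores the square
   4. The value is -1 for [t <> 0] and [q - 1] for [t = 0]. *)
have sum_s t : chi a * \sum_s chi ((bqf a b c).[s, t]) =
               \sum_u chi (u ^+ 2 - t ^+ 2 * D).
  rewrite -[RHS](sum_affine (fun u => chi (u ^+ 2 - _)) (b * t) a4) mulr_sumr.
  apply: eq_bigr => s _; rewrite -chiM // -(chi_sqrM K _ two0) bqfE.
  by congr chi; ring.
suff : chi a * (\sum_s chi ((bqf a b c).[s, 0]) +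
    \sum_(t | t != 0) \sum_s chi ((bqf a b c).[s, t])) = 0.
  by move/eqP; rewrite mulf_eq0; case: (chi_neq0 K a0) => ->;
    rewrite ?oppr_eq0 oner_eq0 => /eqP.
rewrite mulrDr sum_s mulr_sumr [X in _ + X](eq_bigr (fun=> -1)); last first.
  move=> t t0; rewrite sum_s sum_chi_sqrB //.
  by rewrite mulf_neq0 ?expf_neq0 ?bqf_disc_neq0.
rewrite sum_const_neq0 expr0n mul0r.
rewrite (eq_bigr (fun u => chi (u ^+ 2))); last by move=> u _; rewrite subr0.
rewrite (bigD1 0) //= expr0n chi0 add0r (eq_bigr (fun=> 1)).
  by rewrite sum_const_neq0; ring.
by move=> u u0; rewrite chi_sqr.
Qed.

Lemma bqf_Poly : bqf a b c = Poly [:: c%:P * 'X^2; b%:P * 'X; a%:P].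
Proof.
by rewrite /bqf /= !cons_poly_def mul0r add0r !polyCM; ring.
Qed.

(** In [X] the form has degree 2 with unit leading coefficient, so both non-unit factors are linear
    with unit leading coefficients. Thus [g] has a root in [F[Y]], which is evaluated at [Y = 1]. *)
Lemma bqf_factor_root (g h : {poly {poly F}}) : a != 0 ->
    g \isn't a GRing.unit -> h \isn't a GRing.unit -> bqf a b c = g * h ->
  exists r, a * r ^+ 2 + b * r + c = 0.
Proof.
move=> a0 gU hU fE.
have fs : bqf a b c = [:: c%:P * 'X^2; b%:P * 'X; a%:P] :> seq _.
  by rewrite bqf_Poly (@PolyK _ 0) //= polyC_eq0.
have fsz : size (bqf a b c) = 3%N by rewrite fs.
have flead : lead_coef (bqf a b c) = a%:P by rewrite lead_coefE fs.
have f0 : bqf a b c != 0 by rewrite -size_poly_gt0 fsz.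
have [g0 h0] : g != 0 /\ h != 0.
  by apply/andP; rewrite -negb_or -mulf_eq0 -fE.
have gh_size : (size g + size h = 4)%N.
  move: fsz; rewrite fE size_mul //; case: (size g + size h)%N => //= k ->.
  by [].
have [leadg leadh] : lead_coef g \is a GRing.unit /\ lead_coef h \is a GRing.unit.
  apply/andP; rewrite -unitrM -lead_coefM -fE flead.
  by rewrite poly_unitE size_polyC a0 coefC eqxx unitfE a0.
have size_neq1 (p : {poly {poly F}}) : lead_coef p \is a GRing.unit ->
    p \isn't a GRing.unit -> size p != 1%N.
  by move=> + /negP pU; apply: contraTneq => p1; apply/negP; rewrite lead_coefE p1 => p0;
    apply: pU; rewrite poly_unitE p1.
have g_size : size g = 2%N.
  have := size_neq1 g leadg gU; have := size_neq1 h leadh hU.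
  move: g0 h0; rewrite -!size_poly_gt0; lia.
have /(congr1 (horner_eval 1)) : (bqf a b c).[- (g`_0 / g`_1)] = 0.
  rewrite fE hornerM [g.[_]]horner_coef g_size !big_ord_recl big_ord0 /=.
  move: leadg; rewrite lead_coefE g_size /= => g1U.
  by rewrite expr0 expr1 mulr1 addr0 mulrN [g`_1 * _]mulrC divrK // subrr mul0r.
move: (- _) => p; rewrite /horner_eval bqf_Poly !hornerE /= !mulr1 => p0.
by exists p.[1]; rewrite expr2 mulrA -mulrDl.
Qed.

Lemma chi_reducible : reducible_bipoly (bqf a b c) -> chi D = 1.
Proof.
case=> g [h [gU hU fE]]; have [a0|a0] := eqVneq a 0.
  move: bqf_disc_neq0; rewrite a0 mulr0 mul0r subr0 expf_eq0 => /= b0.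
  by rewrite chi_sqr.
have [r r0] := bqf_factor_root a0 gU hU fE.
have DE : D = (2 * a * r + b) ^+ 2.
  transitivity ((2 * a * r + b) ^+ 2 - 4 * a * (a * r ^+ 2 + b * r + c)); first by ring.
  by rewrite r0 mulr0 subr0.
rewrite DE chi_sqr //; apply: contraNneq bqf_disc_neq0 => d0.
by rewrite DE d0 expr0n.
Qed.

Lemma bipoly_unit_horner (g : {poly {poly F}}) s t :
  g \is a GRing.unit -> g.[s, t] != 0.
Proof.
move=> gU; have /eqP := congr1 (fun p : {poly {poly F}} => p.[s, t]) (divrr gU).
by rewrite !hornerM !hornerE /=; apply: contraTneq => ->; rewrite mul0r eq_sym oner_neq0.
Qed.

Lemma chi_irreducible : irreducible_bipoly (bqf a b c) -> chi D = -1.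
Proof.
case=> _ _ f_irr; have [/(chi1_root)[l l0 Dl]|//] := chi_neq0 K bqf_disc_neq0.
case: f_irr; have two0 := two_neq0 F_odd.
(* Linear forms vanish at the origin, which units cannot. *)
have lin_nonunit (s t : F) : s%:P%:P * 'X + t%:P%:P * 'Y \isn't a (@GRing.unit {poly {poly F}}).
  apply/negP => /(@bipoly_unit_horner _ 0 0).
  by rewrite !hornerE /= ?hornerE ?mulr0 ?addr0 eqxx.
have [a0|a0] := eqVneq a 0.
  exists (b%:P%:P * 'X + c%:P%:P * 'Y), (0%:P%:P * 'X + 1%:P%:P * 'Y).
  by split; rewrite ?lin_nonunit // /bqf a0 !polyC0 polyC1; ring.
(* A root of [a r^2 + b r + c], since [l] is a square root of the discriminant. *)
pose r := (l - b) / (2 * a).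
have cE : c = - r * (a * r + b).
  have -> : c = (b ^+ 2 - D) / (4 * a).
    by field; rewrite a0 (_ : 4 = 2 * 2) ?mulf_neq0 //; ring.
  by rewrite Dl /r; field; rewrite a0 two0 (_ : 4 = 2 * 2) ?mulf_neq0 //; ring.
exists (1%:P%:P * 'X + (- r)%:P%:P * 'Y), (a%:P%:P * 'X + (a * r + b)%:P%:P * 'Y).
split; rewrite ?lin_nonunit // /bqf cE; ring.
Qed.

End BinaryForm.

(** * The form in [n + 1] variables: nondegeneracy and distribution of values *)

Section Kappa.

Variables (K : realFieldType) (F : finFieldType) (a b c : F) (n : nat).
Hypothesis F_odd : odd #|F|.
Hypothesis f_nondeg : bqf_nondegenerate (bqf a b c).
Hypotheses (n_odd : odd n) (n_ge3 : (3 <= n)%N).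

Local Notation V := 'rV[F]_n.+1.
Local Notation q := (#|F|%:R : K).
Local Notation m := (n.-1./2).
Local Notation kap := (kappa (n := n) (bqf a b c)).
Local Notation D := (b ^+ 2 - 4 * a * c).
Implicit Types (x y z v : V).

Local Notation ev i := (inord i.*2 : 'I_n.+1).
Local Notation od i := (inord i.*2.+1 : 'I_n.+1).
Local Notation pen := (inord n.-1 : 'I_n.+1).
Local Notation lst := (inord n : 'I_n.+1).

Definition kappa_polar x y : F :=
  \sum_(i < m) (x 0 (ev i) * y 0 (od i) + y 0 (ev i) * x 0 (od i))
  + (2 * a * x 0 pen * y 0 pen + b * (x 0 pen * y 0 lst + y 0 pen * x 0 lst)
     + 2 * c * x 0 lst * y 0 lst).

Lemma kappaE x : kap x = \sum_(i < m) x 0 (ev i) * x 0 (od i)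
  + (a * x 0 pen ^+ 2 + b * x 0 pen * x 0 lst + c * x 0 lst ^+ 2).
Proof. by rewrite /kappa bqfE. Qed.

Lemma kappaZ k x : kap (k *: x) = k ^+ 2 * kap x.
Proof.
rewrite !kappaE mulrDr mulr_sumr !mxE; congr (_ + _); last by ring.
by apply: eq_bigr => i _; rewrite !mxE; ring.
Qed.

Lemma kappaD x y : kap (x + y) = kap x + kap y + kappa_polar x y.
Proof.
rewrite !kappaE /kappa_polar !mxE.
rewrite (eq_bigr (fun i : 'I_m => x 0 (ev i) * x 0 (od i) + y 0 (ev i) * y 0 (od i) +
   (x 0 (ev i) * y 0 (od i) + y 0 (ev i) * x 0 (od i)))); last first.
  by move=> i _; rewrite !mxE; ring.
by rewrite big_split big_split /=; ring.
Qed.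

Lemma kappa_polarDl x y z : kappa_polar (x + y) z = kappa_polar x z + kappa_polar y z.
Proof.
rewrite /kappa_polar !mxE.
rewrite (eq_bigr (fun i : 'I_m => (x 0 (ev i) * z 0 (od i) + z 0 (ev i) * x 0 (od i)) +
   (y 0 (ev i) * z 0 (od i) + z 0 (ev i) * y 0 (od i)))); last first.
  by move=> i _; rewrite !mxE; ring.
by rewrite big_split /=; ring.
Qed.

Lemma kappa_polarZl k x y : kappa_polar (k *: x) y = k * kappa_polar x y.
Proof.
rewrite /kappa_polar !mxE [RHS]mulrDr mulr_sumr; congr (_ + _); last by ring.
by apply: eq_bigr => i _; rewrite !mxE; ring.
Qed.

Let unit_vec (k : nat) : V := delta_mx 0 (inord k).

Let unit_vecE (j k : nat) : (j < n.+1)%N -> (k < n.+1)%N ->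
  unit_vec k 0 (inord j) = (j == k)%:R.
Proof. by move=> jn kn; rewrite mxE eqxx -val_eqE /= !inordK. Qed.

Let unit_vec_eq (j k : nat) : (j < n.+1)%N -> j = k -> unit_vec k 0 (inord j) = 1.
Proof. by move=> jn <-; rewrite unit_vecE // eqxx. Qed.

Let unit_vec_neq (j k : nat) : (j < n.+1)%N -> (k < n.+1)%N -> j != k ->
  unit_vec k 0 (inord j) = 0.
Proof. by move=> jn kn jk; rewrite unit_vecE // (negPf jk). Qed.

Let shift_neq (j k : nat) v t : (j < n.+1)%N -> (k < n.+1)%N -> j != k ->
  (v + t *: unit_vec k) 0 (inord j) = v 0 (inord j).
Proof. by move=> jn kn jk; rewrite mxE [X in _ + X]mxE unit_vec_neq // mulr0 addr0. Qed.

Lemma polar_ev (i : 'I_m) x : kappa_polar (unit_vec i.*2) x = x 0 (od i).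
Proof.
have im := ltn_ord i; rewrite /kappa_polar (bigD1 i) //= big1 => [|j ji].
  rewrite unit_vec_eq ?unit_vec_neq; try lia.
  ring.
have jm := ltn_ord j; rewrite -val_eqE /= in ji.
by rewrite !unit_vec_neq; try lia; ring.
Qed.

Lemma polar_od (i : 'I_m) x : kappa_polar (unit_vec i.*2.+1) x = x 0 (ev i).
Proof.
have im := ltn_ord i; rewrite /kappa_polar (bigD1 i) //= big1 => [|j ji].
  rewrite [unit_vec _ 0 (od i)]unit_vec_eq ?unit_vec_neq; try lia.
  ring.
have jm := ltn_ord j; rewrite -val_eqE /= in ji.
by rewrite !unit_vec_neq; try lia; ring.
Qed.

Lemma kappa_unit_ev (i : 'I_m) : kap (unit_vec i.*2) = 0.
Proof.
have im := ltn_ord i; rewrite kappaE big1 => [|j _].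
  by rewrite ?unit_vec_neq; try lia; ring.
have jm := ltn_ord j.
by rewrite [unit_vec _ 0 (od j)]unit_vec_neq ?mulr0 //; lia.
Qed.

(** Pairing with unit vectors reads off the coordinates in the hyperbolic planes; what remains is
    the radical of the binary form. *)
Lemma kappa_polar_nondeg x : (forall y, kappa_polar x y = 0) -> x = 0.
Proof.
have polarC u v : kappa_polar u v = kappa_polar v u.
  rewrite /kappa_polar; congr (_ + _); last by ring.
  by apply: eq_bigr => i _; ring.
move=> xy0.
have ev0 (i : 'I_m) : x 0 (ev i) = 0 by rewrite -polar_od polarC.
have od0 (i : 'I_m) : x 0 (od i) = 0 by rewrite -polar_ev polarC.
have [pen0 lst0] : x 0 pen = 0 /\ x 0 lst = 0.
  apply: f_nondeg => s t; rewrite -[RHS](xy0 (s *: unit_vec n.-1 + t *: unit_vec n)).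
  rewrite polarC kappa_polarDl !kappa_polarZl {1}/kappa_polar big1 => [|i _].
    rewrite {1}/kappa_polar big1 => [|i _].
      rewrite !unit_vecE; try lia.
      rewrite !eqxx gtn_eqF ?ltn_eqF; try lia.
      by rewrite !bqfE /=; ring.
    have im := ltn_ord i.
    by rewrite ev0 od0 !mulr0 mul0r addr0.
  by rewrite ev0 od0 !mulr0 mul0r addr0.
apply/rowP => k; rewrite mxE.
have [kn|kn] := leqP n k.
  have -> : k = lst by apply/val_inj; rewrite /= inordK //; have := ltn_ord k; lia.
  exact: lst0.
have [kn'|kn'] := leqP n.-1 k.
  have -> : k = pen by apply/val_inj; rewrite /= inordK //; have := ltn_ord k; lia.
  exact: pen0.
have k2m : (k./2 < m)%N by lia.
have [k_odd|k_even] := boolP (odd k).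
  rewrite (_ : k = od (Ordinal k2m)) //; apply/val_inj; rewrite /= inordK; lia.
rewrite (_ : k = ev (Ordinal k2m)) //; apply/val_inj; rewrite /= inordK; lia.
Qed.

Lemma sum_coordinate (k : nat) (phi : V -> K) s : (k < n.+1)%N ->
    (forall v t, phi (v + t *: unit_vec k) = phi v) ->
  \sum_(v : V) (v 0 (inord k) == s)%:R * phi v = q^-1 * \sum_v phi v.
Proof.
move=> kn phiP; rewrite [LHS](sum_average _ (unit_vec k)); congr (_ * _).
apply: eq_bigr => v _; under eq_bigr do rewrite phiP !mxE eqxx /= eqxx mulr1.
rewrite -mulr_suml -[RHS]mul1r; congr (_ * _).
apply: etrans (sum_indicator K s).
rewrite -[RHS](sum_affine (fun u => (u == s)%:R) (v 0 (inord k)) (oner_neq0 F)).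
by apply: eq_bigr => t _; rewrite mulr1.
Qed.

(* The even coordinates span a totally singular subspace, and translating along
   it makes everything outside the vanishing locus of the odd coordinates cancel. *)
Let odds0 k v : K := \prod_(i < k) (v 0 (inord i.*2.+1) == 0)%:R.

Let odds0_ev k j v t : (k <= m)%N -> (j < m)%N ->
  odds0 k (v + t *: unit_vec j.*2) = odds0 k v.
Proof.
move=> km jm; apply: eq_bigr => i _; have := ltn_ord i => ik.
by rewrite shift_neq //; lia.
Qed.

Let odds0_od k v t : (k < m)%N -> odds0 k (v + t *: unit_vec k.*2.+1) = odds0 k v.
Proof.
move=> km; apply: eq_bigr => i _; have := ltn_ord i => ik.
by rewrite shift_neq //; lia.
Qed.

Let sum_odds0 (h : F -> K) k : \sum_s h s = 0 -> (k <= m)%N ->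
  \sum_v odds0 k v * h (kap v) = \sum_v h (kap v).
Proof.
move=> h0; elim: k => [|k IHk] km.
  by apply: eq_bigr => v _; rewrite /odds0 big_ord0 mul1r.
rewrite -IHk ?(ltnW km) //.
(* Translation along the singular unit vector of index [2 k] cancels all [v] whose coordinate
   [2 k + 1] is non-zero. *)
have := sum_not_orthogonal kappaZ kappaD kappa_polarDl kappa_polarZl h0
  (kappa_unit_ev (Ordinal km)) (phi := odds0 k) (fun v t => odds0_ev v t (ltnW km) km).
under eq_bigr do rewrite polar_ev /=.
move=> sum0; rewrite -[LHS]addr0 -[X in _ + X = _]sum0 -big_split /=.
apply: eq_bigr => v _; rewrite /odds0 big_ord_recr /=.
by case: eqP => _ /=; rewrite ?(mulr1, mulr0, mul0r, mul1r, addr0, add0r).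
Qed.

Let sum_odds0_last (g : F -> F -> K) k : (k <= m)%N ->
  \sum_v odds0 k v * g (v 0 pen) (v 0 lst) =
  q ^- k * \sum_(v : V) g (v 0 pen) (v 0 lst).
Proof.
elim: k => [|k IHk] km.
  by rewrite expr0 invr1 mul1r; apply: eq_bigr => v _; rewrite /odds0 big_ord0 mul1r.
transitivity (\sum_(v : V) (v 0 (inord k.*2.+1) == 0)%:R *
   (odds0 k v * g (v 0 pen) (v 0 lst))).
  by apply: eq_bigr => v _; rewrite /odds0 big_ord_recr /=; ring.
rewrite sum_coordinate; [|lia|].
  by rewrite IHk ?(ltnW km) // mulrA exprS invfM.
by move=> v t; rewrite odds0_od // !shift_neq //; lia.
Qed.

Let sum_last (g : F -> F -> K) : \sum_(v : V) g (v 0 pen) (v 0 lst) =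
  q ^- 2 * #|{: V}|%:R * \sum_s \sum_t g s t.
Proof.
transitivity (\sum_s \sum_t \sum_(v : V) (v 0 pen == s)%:R *
    ((v 0 lst == t)%:R * g s t)).
  under [RHS]eq_bigr do rewrite exchange_big.
  rewrite exchange_big; apply: eq_bigr => v _.
  rewrite (bigD1 (v 0 pen)) //= (bigD1 (v 0 lst)) //= !eqxx !mul1r.
  rewrite !big1 ?addr0 // => [s sv|t tv].
    by rewrite big1 // => t _; rewrite eq_sym (negPf sv) mul0r.
  by rewrite [_ == t]eq_sym (negPf tv) mul0r mulr0.
rewrite mulr_sumr; apply: eq_bigr => s _; rewrite mulr_sumr; apply: eq_bigr => t _.
rewrite sum_coordinate; [|lia|].
  rewrite sum_coordinate ?sum_const_type; [|lia|by []].
  by rewrite expr2 invfM; ring.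
by move=> v k; rewrite shift_neq //; lia.
Qed.

Lemma card_rowvec : #|{: V}|%:R = (q * q ^+ m) ^+ 2.
Proof.
rewrite card_mx mul1n natrX -exprS -exprM; congr (_ ^+ _); lia.
Qed.

(** Once the odd coordinates of the hyperbolic planes are zero, [kap] is the binary form; the factor
    arises as [q ^- m * q ^- 2 * #|{: V}| = q ^+ m]. *)
Lemma sum_kappa (h : F -> K) : \sum_s h s = 0 ->
  \sum_v h (kap v) = q ^+ m * \sum_s \sum_t h ((bqf a b c).[s, t]).
Proof.
move=> h0; rewrite -(sum_odds0 h0 (leqnn m)).
transitivity (\sum_v odds0 m v * h ((bqf a b c).[v 0 pen, v 0 lst])).
  apply: eq_bigr => v _; have [->|odds_neq0] := eqVneq (odds0 m v) 0.
    by rewrite !mul0r.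
  rewrite /kappa big1 ?add0r // => i _.
  move/prodf_neq0: odds_neq0 => /(_ i isT).
  by have [->|_] := eqVneq (v 0 (od i)) 0; rewrite ?mulr0 ?eqxx.
rewrite (sum_odds0_last (fun s t => h ((bqf a b c).[s, t]))) //.
rewrite (sum_last (fun s t => h ((bqf a b c).[s, t]))) card_rowvec mulrA.
by congr (_ * _); field; rewrite expf_neq0 ?q_neq0.
Qed.

Lemma sum_delta_kappa :
  \sum_v delta K (kap v) = chi K D * (q * q ^+ m) * (q - 1).
Proof. by rewrite sum_kappa ?sum_delta // sum_delta_bqf //; ring. Qed.

Lemma sum_chi_kappa : \sum_v chi K (kap v) = 0.
Proof. by rewrite sum_kappa ?sum_chi // sum_chi_bqf // mulr0. Qed.

End Kappa.

(** * Anisotropic points and lines *)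

Section Points.

Variables (K : realType) (F : finFieldType) (a b c : F) (n : nat).
Hypothesis F_odd : odd #|F|.

Local Notation V := 'rV[F]_n.+1.
Local Notation q := (#|F|%:R : K).
Local Notation f := (bqf a b c).
Local Notation kap := (kappa (n := n) f).
Local Notation B := (kappa_polar a b c (n := n)).
Local Notation pt := {M : 'M[F]_n.+1 | anisotropic f M}.
Local Notation chi := (chi K).
Implicit Types (i j k : pt) (v x y : V).

Definition rep i : V := nz_row (val i).

Lemma pgpoint_genmx v : v != 0 -> pgpoint <<v>>%MS.
Proof. by move=> v0; rewrite /pgpoint genmx_id eqxx /= genmxE rank_rV v0. Qed.

Lemma pgpoint_row (M : 'M[F]_n.+1) : pgpoint M ->
  nz_row M != 0 /\ M = <<nz_row M>>%MS.
Proof.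
case/andP => /eqP M_gen /eqP M1; have M0 : nz_row M != 0.
  by rewrite nz_row_eq0 -mxrank_eq0 M1.
split=> //; rewrite -[LHS]M_gen; apply/esym/genmxP.
rewrite -(geq_leqif (mxrank_leqif_eq (nz_row_sub M))).
by rewrite M1 rank_rV M0.
Qed.

Lemma genmx_scale v (l : F) : l != 0 -> <<l *: v>>%MS = <<v>>%MS.
Proof. by move=> l0; apply/eq_genmx/eqmx_scale. Qed.

Lemma coordvP v x : v != 0 ->
  reflect (exists2 l, l != 0 & x = l *: v) (coordv <<v>>%MS x).
Proof.
move=> v0; rewrite /coordv genmxE; apply: (iffP andP).
  case=> x0 /sub_rVP[l xE]; exists l => //.
  by apply: contraNneq x0 => l0; rewrite xE l0 scale0r.
by case=> l l0 ->; rewrite scaler_eq0 negb_or l0 v0; split=> //; apply/sub_rVP; exists l.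
Qed.

Lemma genmx_eqP v x : v != 0 -> x != 0 ->
  reflect (exists2 l, l != 0 & x = l *: v) (<<x>>%MS == <<v>>%MS).
Proof.
move=> v0 x0; apply: (iffP eqP) => [xv|[l l0 ->]]; last by rewrite genmx_scale.
by apply/(coordvP _ v0); rewrite /coordv x0 -xv genmxE submx_refl.
Qed.

Lemma on_quadric_genmx v : v != 0 -> on_quadric f <<v>>%MS = (kap v == 0).
Proof.
move=> v0; rewrite /on_quadric pgpoint_genmx //=.
apply/forallP/idP => [/(_ v)/implyP->//|/eqP kv x].
  by apply/(coordvP _ v0); exists 1; rewrite ?oner_eq0 ?scale1r.
by apply/implyP => /(coordvP _ v0)[l _ ->]; rewrite kappaZ kv mulr0.
Qed.

Lemma anisotropic_genmx v : kap v != 0 -> anisotropic f <<v>>%MS.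
Proof.
move=> kv; have v0 : v != 0.
  by apply: contraNneq kv => ->; rewrite -(scale0r 0) kappaZ expr0n mul0r.
by rewrite /anisotropic pgpoint_genmx // on_quadric_genmx.
Qed.

Lemma rep_spec i : [/\ rep i != 0, val i = <<rep i>>%MS & kap (rep i) != 0].
Proof.
have /andP[pi] := valP i; have [r0 iE] := pgpoint_row pi.
by rewrite {1}iE on_quadric_genmx // => kr; split.
Qed.

Lemma rep_neq0 i : rep i != 0. Proof. by have [] := rep_spec i. Qed.
Lemma val_rep i : val i = <<rep i>>%MS. Proof. by have [] := rep_spec i. Qed.
Lemma kappa_rep i : kap (rep i) != 0. Proof. by have [] := rep_spec i. Qed.

(** Every non-singular vector spans exactly one anisotropic point, whose non-zero vectors are the
    [q - 1] multiples of its representative. *)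
Lemma sum_rep (phi : V -> K) : (forall l z, l != 0 -> phi (l *: z) = phi z) ->
  \sum_(v | kap v != 0) phi v = (q - 1) * \sum_i phi (rep i).
Proof.
move=> phiZ.
have line_sum i : (q - 1) * phi (rep i) = \sum_(v | coordv (val i) v) phi v.
  have [d rk] : exists d, rep i 0 d != 0 by apply/rV0Pn/rep_neq0.
  rewrite -(sum_const_neq0 F) [RHS](reindex (fun l => l *: rep i)) /=; last first.
    exists (fun v => v 0 d / rep i 0 d) => v.
      by rewrite !mxE mulfK.
    rewrite inE val_rep => /(coordvP _ (rep_neq0 i))[l _ ->].
    by rewrite !mxE mulfK.
  apply: eq_big => [l|l l0]; last by rewrite phiZ.
  rewrite val_rep; apply/idP/(coordvP _ (rep_neq0 i)) => [l0|]; first by exists l.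
  case=> l' l'0 /eqP; rewrite -subr_eq0 -scalerBl scaler_eq0 (negPf (rep_neq0 i)).
  by rewrite orbF subr_eq0 => /eqP->.
rewrite mulr_sumr (eq_bigr _ (fun i _ => line_sum i)).
under [RHS]eq_bigr do rewrite big_mkcond.
rewrite exchange_big big_mkcond /=; apply: eq_bigr => v _.
case: ifPn => [kv|/negPn/eqP kv]; last first.
  rewrite big1 // => i _; case: ifP => //; rewrite val_rep.
  case/(coordvP _ (rep_neq0 i)) => l l0 vE; move: kv.
  by rewrite vE kappaZ => /eqP; rewrite mulf_eq0 expf_eq0 (negPf l0) (negPf (kappa_rep i)).
have v0 : v != 0.
  by apply: contraNneq kv => ->; rewrite -(scale0r 0) kappaZ expr0n mul0r.
rewrite -big_mkcond /= (big_pred1 (Sub <<v>>%MS (anisotropic_genmx kv))) // => i /=.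
rewrite -val_eqE /= val_rep eq_sym; apply/(coordvP _ (rep_neq0 i))/(genmx_eqP (rep_neq0 i) v0).
  by [].
by [].
Qed.

Lemma rep_indep i j (s t : F) : i != j -> s *: rep i + t *: rep j = 0 -> s = 0 /\ t = 0.
Proof.
move=> ij st0; have [s0|s0] := eqVneq s 0.
  move: st0; rewrite s0 scale0r add0r => /eqP.
  by rewrite scaler_eq0 (negPf (rep_neq0 j)) orbF => /eqP.
case/eqP: ij; apply: val_inj; rewrite !val_rep; apply/eqP.
apply/genmx_eqP; rewrite ?rep_neq0 //.
have riE : rep i = (- (t / s)) *: rep j.
  apply: (scalerI s0); rewrite scalerA mulrN mulrC divfK // scaleNr.
  by apply/eqP; rewrite -addr_eq0 st0.
exists (- (t / s)) => //; apply: contraNneq (rep_neq0 i) => l0.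
by rewrite riE l0 scale0r.
Qed.

Lemma rep_parallel i j : parallel K (rep i) (rep j) = (i == j)%:R.
Proof.
rewrite /parallel; have [->|ij] := eqVneq i j; last first.
  rewrite big1 // => l _; case: eqP => // st0.
  have [|/eqP] := @rep_indep i j 1 l ij; first by rewrite scale1r.
  by rewrite oner_eq0.
rewrite (eq_bigr (fun l => (l == -1)%:R)) => [|l _].
  rewrite (bigD1 (-1)) ?oppr_eq0 ?oner_eq0 //= eqxx big1 ?addr0 //.
  by move=> l /andP[_ /negPf->].
rewrite -{1}[rep j]scale1r -scalerDl scaler_eq0 (negPf (rep_neq0 j)) orbF.
by rewrite addrC addr_eq0.
Qed.

Local Notation disc := (disc kap B).

(** The vectors [rep i + l *: rep j] represent all points of the line except [j] itself, which is
    anisotropic, so [line_count] misses no point of the quadric. *)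
Lemma line_meetsE i j : i != j ->
  (line_meets f (val i) (val j))%:R = 1 + chi (disc (rep i) (rep j)).
Proof.
move=> ij; rewrite -(line_count K F_odd (@kappaZ F a b c n) (@kappaD F a b c n)
  (@kappa_polarZl F a b c n) _ (kappa_rep j)).
transitivity (#|[set l | kap (rep i + l *: rep j) == 0]|%:R : K); last first.
  by rewrite -sum1_card natr_sum big_mkcond; apply: eq_bigr => l _; rewrite inE; case: ifP.
have line_neq0 l : rep i + l *: rep j != 0.
  apply/eqP => st0; have [|/eqP] := @rep_indep i j 1 l ij; first by rewrite scale1r.
  by rewrite oner_eq0.
rewrite /line_meets; congr _%:R.
rewrite -(card_in_imset (f := fun l => <<rep i + l *: rep j>>%MS)); last first.
  move=> l l' _ _ /eqP /(genmx_eqP (line_neq0 l') (line_neq0 l))[k k0 lE].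
  have [|/eqP] := @rep_indep i j (1 - k) (l - k * l') ij.
    rewrite !scalerBl scale1r addrACA -opprD -scalerA -scalerDr -lE.
    by rewrite subrr.
  by rewrite subr_eq0 => /eqP <-; rewrite mul1r => /eqP; rewrite subr_eq0 => /eqP.
apply: eq_card => Z; rewrite inE; apply/andP/imsetP => [[Zq Zl]|[l + ->]]; last first.
  rewrite inE => kl; rewrite on_quadric_genmx //; split=> //.
  by rewrite genmxE addmx_sub_adds ?scalemx_sub // val_rep genmxE.
have /andP[Zpt _] := Zq; have [z0 ZE] := pgpoint_row Zpt.
move: (nz_row Z) z0 ZE Zq Zl => z z0 ->; rewrite on_quadric_genmx // => /eqP kz.
rewrite !val_rep !genmxE (adds_eqmx (genmxE _) (genmxE _)) => /sub_addsmxP[[u w] /= zE].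
rewrite [u]mx11_scalar [w]mx11_scalar !mul_scalar_mx in zE.
move: (u 0 0) (w 0 0) zE => s t zE {u w}.
have s0 : s != 0.
  apply: contraNneq z0 => s0; move: kz; rewrite zE s0 scale0r add0r kappaZ => /eqP.
  by rewrite mulf_eq0 (negPf (kappa_rep j)) orbF expf_eq0 /= => /eqP->; rewrite scale0r.
have zE' : z = s *: (rep i + (t / s) *: rep j).
  by rewrite zE scalerDr scalerA [s * _]mulrC divfK.
exists (t / s); last by rewrite zE' genmx_scale.
rewrite inE; move/eqP: kz; rewrite zE' kappaZ mulf_eq0 expf_eq0 (negPf s0) //.
Qed.

Local Notation sgn := (type_sign K kap rep).

Lemma quadtypeE i : quadtype f (val i) = if sgn i == 1 then nzsquares F else nonsquares F.
Proof.
rewrite /quadtype /type_sign; congr (if _ then _ else _).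
have chi_nzsquares s : (s \in nzsquares F) = (chi s == 1).
  apply/imsetP/eqP => [[l]|/chi1_root[l l0 ->]]; last by exists l; rewrite ?inE.
  by rewrite !inE => l0 ->; rewrite chi_sqr.
rewrite val_rep; apply/existsP/eqP => [[x /andP[/(coordvP _ (rep_neq0 i))[l l0 ->]]]|r1].
  by rewrite kappaZ chi_nzsquares chi_sqrM // => /eqP.
exists (rep i); rewrite chi_nzsquares r1 eqxx andbT.
by apply/(coordvP _ (rep_neq0 i)); exists 1; rewrite ?oner_eq0 ?scale1r.
Qed.

Lemma nzsquares_neq : nzsquares F != nonsquares F.
Proof.
apply/negP => /eqP /setP /(_ 1); rewrite !inE.
have -> : 1 \in nzsquares F by apply/imsetP; exists 1; rewrite ?inE ?oner_eq0 ?expr1n.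
by move/esym/negP; case; apply/imsetP; exists 1; rewrite ?expr1n.
Qed.

Lemma sgn_cases i : sgn i = 1 \/ sgn i = -1.
Proof. exact/chi_neq0/kappa_rep. Qed.

Lemma N1_neq1 : (-1 == 1 :> K) = false.
Proof. by rewrite eq_sym -subr_eq0 opprK (pnatr_eq0 _ 2). Qed.

Lemma mulqtE i j : mulqt (quadtype f (val i)) (quadtype f (val j)) =
  if sgn i * sgn j == 1 then nzsquares F else nonsquares F.
Proof.
rewrite /mulqt !quadtypeE.
have [-> | ->] := sgn_cases i; have [-> | ->] := sgn_cases j;
  rewrite ?mulrNN ?mulr1 ?mul1r ?eqxx ?N1_neq1 ?eqxx //.
  by rewrite (negPf nzsquares_neq).
by rewrite eq_sym (negPf nzsquares_neq).
Qed.

(** For distinct points: 0, 1 or -1 as the line joining them is tangent, secant or external. *)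
Definition line_type i j : K := chi (disc (rep i) (rep j)).
Local Notation eta := line_type.

Definition rel_index i j : nat :=
  if i == j then 0%N else if eta i j == 0 then 1%N
  else if eta i j == 1 then (if sgn i * sgn j == 1 then 2%N else 4%N)
  else (if sgn i * sgn j == 1 then 3%N else 5%N).

Lemma quadrelE (k : 'I_6) i j : quadrel k i j = (val k == rel_index i j).
Proof.
rewrite /quadrel mulqtE /rel_index; have [ij|ij] := eqVneq i j.
  by case: k => [[|[|[|[|[|[|//]]]]]] Hk].
have := line_meetsE ij; rewrite -/(eta i j).
have eta_cases : [\/ eta i j = 0, eta i j = 1 | eta i j = -1].
  rewrite /line_type; have [->|d0] := eqVneq (disc (rep i) (rep j)) 0.
    by rewrite chi0; constructor 1.
  by have [->|->] := chi_neq0 K d0; [constructor 2|constructor 3].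
have tE : ((if sgn i * sgn j == 1 then nzsquares F else nonsquares F) == nzsquares F)
          = (sgn i * sgn j == 1).
  by case: ifP => _; rewrite ?eqxx // eq_sym (negPf nzsquares_neq).
have tE' : ((if sgn i * sgn j == 1 then nzsquares F else nonsquares F) == nonsquares F)
          = (sgn i * sgn j != 1).
  by case: ifP => _; rewrite ?eqxx // (negPf nzsquares_neq).
rewrite tE tE'.
case: eta_cases => ->; rewrite ?addr0 ?subrr => /eqP.
- rewrite (eqr_nat K _ 1) => /eqP ->; rewrite !eqxx.
  by case: k => [[|[|[|[|[|[|//]]]]]] Hk] /=.
- rewrite (eqr_nat K _ 2) => /eqP ->; rewrite !eqxx oner_eq0.
  by case: k => [[|[|[|[|[|[|//]]]]]] Hk] /=; case: ifP.
rewrite (pnatr_eq0 K) => /eqP ->; rewrite oppr_eq0 oner_eq0 N1_neq1.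
by case: k => [[|[|[|[|[|[|//]]]]]] Hk] /=; case: ifP.
Qed.

End Points.

(** * The eigenmatrices *)

(* The entry of the j-th idempotent at a pair of points, in terms of the entries
   I, s, p, t there of the identity, the sign, the projection and the tangency
   matrices. *)
Definition idempotent_entry (K : realType) (c x q e : K) (j : nat) (I s p t : K) : K :=
  let u := e / x * (t - (1 + s) * (e * x / q * p + q^-1)) in
  nth 0 [:: c^-1; s / c; p - c^-1; s * (p - c^-1);
    (I - (1 + s) * p + u) / 2; (I - (1 + s) * p - u) / 2] j.

Section EigenmatrixProduct.

Variables (K : realType) (q e x : K) (n : nat).
Hypotheses (n_odd : odd n) (n_ge3 : (3 <= n)%N).
Hypotheses (q_ge3 : 3 <= q) (xE : x = q ^+ n.-1./2) (e_pm1 : e = 1 \/ e = -1).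

Lemma qR_neq0 : q != 0. Proof. by apply: lt0r_neq0; move: q_ge3; lra. Qed.
Lemma qB1_neq0 : q - 1 != 0. Proof. by apply: lt0r_neq0; move: q_ge3; lra. Qed.
Lemma qD1_neq0 : q + 1 != 0. Proof. by apply: lt0r_neq0; move: q_ge3; lra. Qed.

Lemma x_ge3 : 3 <= x.
Proof.
have [k kE] : exists k, n.-1./2 = k.+1 by exists n.-1./2.-1; lia.
have : 1 <= q ^+ k by apply: exprn_ege1; move: q_ge3; lra.
by rewrite xE kE exprS; move: q_ge3; nra.
Qed.

Lemma x_neq0 : x != 0. Proof. by apply: lt0r_neq0; move: x_ge3; lra. Qed.

Lemma pow_n1 : q ^+ n.-1 = x ^+ 2.
Proof. by rewrite xE -exprM; congr (_ ^+ _); lia. Qed.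

Lemma pow_m1 : q ^+ n.-1./2.-1 = x / q.
Proof.
have [k kE] : exists k, n.-1./2 = k.+1 by exists n.-1./2.-1; lia.
by rewrite xE kE exprS mulrC mulKf // qR_neq0.
Qed.

Lemma pow_mS : q ^+ n.-1./2.+1 = q * x.
Proof. by rewrite xE exprS. Qed.

Lemma xqBe_neq0 : x * q - e != 0.
Proof. by apply: lt0r_neq0; move: q_ge3 x_ge3; case: e_pm1 => ->; nra. Qed.

Let pows := (pow_n1, pow_m1, pow_mS).

Lemma PmxE i j : Pmx q e n i j = nth 0 (nth [::] [::
  [:: 1; x ^+ 2 - 1; 1 / 4 * x * (x + e) * (q - 3); 1 / 4 * x * (x - e) * (q - 1);
      1 / 4 * x * (x + e) * (q - 1); 1 / 4 * x * (x - e) * (q + 1)];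
  [:: 1; x ^+ 2 - 1; 1 / 4 * x * (x + e) * (q - 3); 1 / 4 * x * (x - e) * (q - 1);
      - (1 / 4 * x * (x + e) * (q - 1)); - (1 / 4 * x * (x - e) * (q + 1))];
  [:: 1; e * (x / q) - 1; 1 / 4 * e * (x / q) * (q + 1) * (q - 3);
      - (1 / 4 * e * (x / q) * (q - 1) ^+ 2); 1 / 4 * e * (x / q) * (q - 1) * (q + 1);
      - (1 / 4 * e * (x / q) * (q - 1) * (q + 1))];
  [:: 1; e * (x / q) - 1; 1 / 4 * e * (x / q) * (q + 1) * (q - 3);
      - (1 / 4 * e * (x / q) * (q - 1) ^+ 2); - (1 / 4 * e * (x / q) * (q - 1) * (q + 1));
      1 / 4 * e * (x / q) * (q - 1) * (q + 1)];
  [:: 1; e * x - 1; - (e * x); 0; 0; 0];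
  [:: 1; - (e * x) - 1; 0; e * x; 0; 0]] i) j.
Proof. by rewrite mxE !pows -!xE. Qed.

Lemma QmxE i j : Qmx q e n i j = nth 0 (nth [::] [::
  [:: 1; 1; q ^+ 2 * ((x ^+ 2 - 1) / (q ^+ 2 - 1)); q ^+ 2 * ((x ^+ 2 - 1) / (q ^+ 2 - 1));
      (q - 3) / (2 * (q - 1)) * (x + e) * (q * x - e);
      (q - 1) / (2 * (q + 1)) * (x - e) * (q * x - e)];
  [:: 1; 1; q ^+ 2 * ((e * (x / q) - 1) / (q ^+ 2 - 1));
      q ^+ 2 * ((e * (x / q) - 1) / (q ^+ 2 - 1));
      e * ((q - 3) / (2 * (q - 1))) * (q * x - e);
      - (e * ((q - 1) / (2 * (q + 1))) * (q * x - e))];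
  [:: 1; 1; e * (q / (q - 1)) * (x - e); e * (q / (q - 1)) * (x - e);
      - (e * (2 / (q - 1)) * (q * x - e)); 0];
  [:: 1; 1; - (e * (q / (q + 1)) * (x + e)); - (e * (q / (q + 1)) * (x + e));
      0; e * (2 / (q + 1)) * (q * x - e)];
  [:: 1; -1; e * (q / (q - 1)) * (x - e); - (e * (q / (q - 1)) * (x - e)); 0; 0];
  [:: 1; -1; - (e * (q / (q + 1)) * (x + e)); e * (q / (q + 1)) * (x + e); 0; 0]] i) j.
Proof. by rewrite mxE !pows -!xE. Qed.

Lemma q_sqrB1_neq0 : q ^+ 2 - 1 != 0.
Proof. by apply: lt0r_neq0; move: q_ge3; nra. Qed.

(** With the powers of [q] expressed through [x], each entry is a rational identity in [q] and [x]
    once the sign [e] is fixed. *)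
Lemma Pmx_Qmx : Pmx q e n *m Qmx q e n = (x * (x * q - e))%:M.
Proof.
apply/matrixP => i j; rewrite mxE.
under eq_bigr do rewrite PmxE QmxE.
rewrite !big_ord_recl big_ord0 mxE.
have := (qR_neq0, qB1_neq0, qD1_neq0, q_sqrB1_neq0) => nz.
by case: i => [[|[|[|[|[|[|//]]]]]] ?]; case: j => [[|[|[|[|[|[|//]]]]]] ?] /=;
  rewrite ?mulr1n ?mulr0n; case: e_pm1 => ->; field; rewrite ?nz.
Qed.

(** Only the valency of [R_2] can vanish, through its factor [q - 3]. *)
Lemma Pmx_valency (i : 'I_6) : (val i == 2%N -> q != 3) -> Pmx q e n ord0 i != 0.
Proof.
move=> i2; have x3 := x_ge3; have x0 := x_neq0.
have [qB1 qD1] := (qB1_neq0, qD1_neq0).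
have [nz1 nz4] : (1 : K) != 0 /\ (4^-1 : K) != 0 by rewrite oner_neq0 invr_eq0 pnatr_eq0.
have x2 : x ^+ 2 - 1 != 0 by apply: lt0r_neq0; nra.
have [xD xB] : x + e != 0 /\ x - e != 0.
  by case: e_pm1 => ->; split; apply: lt0r_neq0; lra.
rewrite PmxE; case: i i2 => [[|[|[|[|[|[|//]]]]]] ?] //= i2;
  do ?[apply: mulf_neq0] => //.
by rewrite subr_eq0 i2.
Qed.

(** The lists tabulate, for each relation [R_r], the identity, the product of types, the line type
    (inside the projection entry) and the tangency; [rel_index_values] matches them with pairs of
    points. *)
Lemma idempotent_entryE (r j : 'I_6) :
  idempotent_entry (x * (x * q - e)) x q e j
    (nth 0 [:: 1; 0; 0; 0; 0; 0] r) (nth 0 [:: 1; 1; 1; 1; -1; -1] r)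
    (e * (1 + q * nth 0 [:: 0; 0; 1; -1; 1; -1] r
          + e * q * x * nth 0 [:: 1; 0; 0; 0; 0; 0] r) / (x * (q ^+ 2 - 1)))
    (nth 0 [:: 1; 1; 0; 0; 0; 0] r)
  = (x * (x * q - e))^-1 * Qmx q e n r j.
Proof.
rewrite QmxE /idempotent_entry.
have := xqBe_neq0; have := x_neq0.
have := (qR_neq0, qB1_neq0, qD1_neq0, q_sqrB1_neq0).
case: e_pm1 => ->; rewrite ?opprK => nz x0 c0; case: r => [[|[|[|[|[|[|//]]]]]] ?];
  case: j => [[|[|[|[|[|[|//]]]]]] ?] /=; field; by rewrite ?nz ?x0 ?c0.
Qed.

End EigenmatrixProduct.

(** * The idempotents and the scheme of the quadric *)

Section Assembly.

Variables (K : realType) (F : finFieldType) (a b c : F) (n : nat) (e : K).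
Hypothesis F_odd : odd #|F|.
Hypothesis f_nondeg : bqf_nondegenerate (bqf a b c).
Hypotheses (n_odd : odd n) (n_ge3 : (3 <= n)%N).
Hypothesis eE : chi K (b ^+ 2 - 4 * a * c) = e.

Local Notation q := (#|F|%:R : K).
Local Notation f := (bqf a b c).
Local Notation kap := (kappa (n := n) f).
Local Notation B := (kappa_polar a b c (n := n)).
Local Notation pt := {M : 'M[F]_n.+1 | anisotropic f M}.
Local Notation ptF := (pt : finType).
Local Notation disc := (disc kap B).
Local Notation rep := (@rep F a b c n).
Local Notation x := (q ^+ n.-1./2).
Local Notation sgn := (type_sign K kap rep).
Local Notation eta := (@line_type K F a b c n).
Local Notation tan := (tangent K kap B rep).
Local Notation prj := (proj kap B x rep).
Local Notation c0 := (#|{: pt}|%:R : K).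
Implicit Types i j k : pt.

Let kZ := @kappaZ F a b c n.
Let kD := @kappaD F a b c n.
Let BDl := @kappa_polarDl F a b c n.
Let BZl := @kappa_polarZl F a b c n.
Let Bnd := kappa_polar_nondeg F_odd f_nondeg n_odd n_ge3.
Let cV : #|{: 'rV[F]_n.+1}|%:R = (q * x) ^+ 2 := card_rowvec K F_odd n_odd n_ge3.
Let e_pm1 : e = 1 \/ e = -1.
Proof. by rewrite -eE; apply/chi_neq0/bqf_disc_neq0. Qed.
Let e_sqr : e * e = 1.
Proof. by case: e_pm1 => ->; rewrite ?mulrNN mulr1. Qed.
Let sD : \sum_(v : 'rV[F]_n.+1) delta K (kap v) = e * (q * x) * (q - 1).
Proof. by rewrite sum_delta_kappa // eE. Qed.
Let sC := sum_chi_kappa K F_odd f_nondeg n_odd n_ge3.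
Let rN := @kappa_rep F a b c n.
Let rS := @sum_rep K F a b c n.
Let rP := @rep_parallel K F a b c n.

Let q_ge3 : 3 <= q.
Proof.
rewrite (ler_nat K 3); have := card_gt1 F; move: F_odd.
by case: #|F| => [|[|[|]]].
Qed.

Let c0E : c0 = x * (x * q - e).
Proof. exact: (card_pt cV sD (pt := ptF) rS). Qed.

Let c0_neq0 : c0 != 0.
Proof.
rewrite c0E mulf_neq0 //.
  exact: (x_neq0 n_odd n_ge3 q_ge3 erefl).
exact: (xqBe_neq0 n_odd n_ge3 q_ge3 erefl e_pm1).
Qed.

Definition kmx (g : pt -> pt -> K) : 'M[K]_#|{: pt}| :=
  \matrix_(u, v) g (enum_val u) (enum_val v).

Lemma kmxM g h : kmx g *m kmx h = kmx (fun i j => \sum_k g i k * h k j).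
Proof.
apply/matrixP => u v; rewrite !mxE [RHS](reindex (@enum_val pt predT)) /=.
  by apply: eq_bigr => w _; rewrite !mxE.
exact/onW_bij/enum_val_bij.
Qed.

Lemma eq_kmx g h : (forall i j, g i j = h i j) -> kmx g = kmx h.
Proof. by move=> gh; apply/matrixP => u v; rewrite !mxE. Qed.

Lemma kmxD g h : kmx g + kmx h = kmx (fun i j => g i j + h i j).
Proof. by apply/matrixP => u v; rewrite !mxE. Qed.

Lemma kmxB g h : kmx g - kmx h = kmx (fun i j => g i j - h i j).
Proof. by apply/matrixP => u v; rewrite !mxE. Qed.

Lemma kmxZ s g : s *: kmx g = kmx (fun i j => s * g i j).
Proof. by apply/matrixP => u v; rewrite !mxE. Qed.

Lemma kmx_scalar s : s%:M = kmx (fun i j => s * (i == j)%:R).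
Proof.
by apply/matrixP => u v; rewrite !mxE (inj_eq enum_val_inj) mulr_natr.
Qed.

Definition sign_mx := kmx (fun i j => (i == j)%:R * sgn j).
Definition all_mx := kmx (fun _ _ => 1).

Lemma sign_mxM g : sign_mx *m kmx g = kmx (fun i j => sgn i * g i j).
Proof.
rewrite kmxM; apply: eq_kmx => i j.
under eq_bigr do rewrite eq_sym -mulrA.
by rewrite sum_pred1.
Qed.

Lemma mul_sign_mx g : kmx g *m sign_mx = kmx (fun i j => g i j * sgn j).
Proof.
rewrite kmxM; apply: eq_kmx => i j.
under eq_bigr do rewrite mulrCA.
by rewrite sum_pred1.
Qed.

Local Notation E := (idempotent all_mx sign_mx (kmx prj) (kmx tan) c0 x e).

Lemma idempotents_ortho (i j : 'I_6) : E i *m E j = if i == j then E i else 0.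
Proof.
have sgn2 i0 : sgn i0 * sgn i0 = 1 by exact: (type_sign_sqr K (pt := ptF) rN).
have prj1 i0 : \sum_k prj i0 k = 1
  by exact: (proj_one kZ kD BDl BZl Bnd e_sqr cV sD (pt := ptF) rN rS).
have prjC i0 j0 : prj i0 j0 = prj j0 i0 by exact: (proj_sym kap B x (pt := ptF)).
have tanC i0 j0 : tan i0 j0 = tan j0 i0 by exact: (tangent_sym K kD (pt := ptF)).
have tanprj i0 j0 : \sum_k tan i0 k * prj k j0 = e * x / q * prj i0 j0 + q^-1.
  by exact: (tangent_proj F_odd kZ kD BDl BZl Bnd e_sqr cV sD (pt := ptF) rN rS).
apply: (idempotent_ortho (q := q)) => //.
- exact: (x_neq0 n_odd n_ge3 q_ge3 erefl).
- rewrite kmxM kmxZ; apply: eq_kmx => i0 j0.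
  by rewrite sum_const_type mulr1.
- by rewrite kmxM; apply: eq_kmx => i0 j0;
    exact: (proj_proj kZ kD BDl BZl Bnd e_sqr cV sD (pt := ptF) rN rS).
- rewrite kmxM; apply: eq_kmx => i0 j0.
  by rewrite -[RHS](prj1 j0); apply: eq_bigr => k _; rewrite mul1r.
- rewrite kmxM; apply: eq_kmx => i0 j0.
  by rewrite -[RHS](prj1 i0); apply: eq_bigr => k _; rewrite mulr1.
- rewrite mul_sign_mx kmx_scalar; apply: eq_kmx => i0 j0.
  by rewrite mul1r -mulrA sgn2 mulr1.
- rewrite mul_sign_mx kmxM -(scale0r all_mx) kmxZ; apply: eq_kmx => i0 j0.
  by rewrite mul0r; exact: (proj_sign_proj F_odd kZ kD BDl BZl x sC (pt := ptF) rS).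
- by rewrite kmxM !kmxZ kmxD; apply: eq_kmx => i0 j0; rewrite tanprj mulr1.
(* [M S] is the transpose of [S M], as both kernels are symmetric. *)
- rewrite kmxM !kmxZ kmxD; apply: eq_kmx => i0 j0.
  by rewrite mulr1 prjC -tanprj; apply: eq_bigr => k _; rewrite mulrC tanC prjC.
- rewrite mul_sign_mx sign_mxM; apply: eq_kmx => i0 j0.
  exact: (tangent_sign K B F_odd (pt := ptF) rN).
- rewrite kmxM !sign_mxM !mul_sign_mx !kmxD !kmxZ kmx_scalar kmxD kmxB.
  apply: eq_kmx => i0 j0.
  transitivity (x ^+ 2 * (i0 == j0)%:R
    + (1 + sgn i0 * sgn j0) * (x ^+ 2 / q + e * x / q ^+ 2
       - x ^+ 2 * (1 - (q ^+ 2)^-1) * prj i0 j0)).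
    exact: (tangent_tangent F_odd kZ kD BDl BZl Bnd e_sqr cV sD (pt := ptF) rN rS rP).
  by ring.
Qed.

Local Notation index := (@rel_index K F a b c n).

Lemma rel_index_values i j : [/\ (i == j)%:R = nth 0 [:: 1; 0; 0; 0; 0; 0] (index i j) :> K,
  eta i j = nth 0 [:: 0; 0; 1; -1; 1; -1] (index i j),
  sgn i * sgn j = nth 0 [:: 1; 1; 1; 1; -1; -1] (index i j)
  & tan i j = nth 0 [:: 1; 1; 0; 0; 0; 0] (index i j)].
Proof.
have tan_eta : tan i j = (eta i j == 0)%:R.
  rewrite /tangent /line_type; have [->|d0] := eqVneq (disc _ _) 0.
    by rewrite chi0 eqxx.
  by have [->|->] := chi_neq0 K d0; rewrite ?oppr_eq0 oner_eq0.
rewrite tan_eta /rel_index; have [<-|ij] := eqVneq i j.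
  have -> : eta i i = 0.
    rewrite /line_type (_ : disc _ _ = 0) ?chi0 //.
    by rewrite /disc (Bxx kZ kD); ring.
  by rewrite eqxx (type_sign_sqr K (pt := ptF) rN).
have [eta0|eta0] := eqVneq (eta i j) 0.
  split=> //; have := tangent_sign K B F_odd (pt := ptF) rN i j.
  rewrite tan_eta eta0 eqxx mul1r mulr1 => ->.
  exact: (type_sign_sqr K (pt := ptF) rN).
have [etaE|etaE] : eta i j = 1 \/ eta i j = -1.
  by apply: chi_neq0; apply: contraNneq eta0 => d0; rewrite /line_type d0 chi0.
all: rewrite etaE ?eqxx ?(N1_neq1 K).
all: have [-> | ->] := sgn_cases K i; have [-> | ->] := sgn_cases K j.
all: by rewrite ?mulrNN ?mulrN1 ?mulN1r ?mulr1 ?eqxx ?(N1_neq1 K).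
Qed.

Lemma index_lt6 i j : (index i j < 6)%N.
Proof. by rewrite /rel_index; do ![case: ifP => // _]. Qed.

Lemma idempotent_kmx (j : 'I_6) : E j = kmx (fun i k =>
  idempotent_entry c0 x q e j (i == k)%:R (sgn i * sgn k) (prj i k) (tan i k)).
Proof.
have tanprj i0 j0 : \sum_k tan i0 k * prj k j0 = e * x / q * prj i0 j0 + q^-1.
  by exact: (tangent_proj F_odd kZ kD BDl BZl Bnd e_sqr cV sD (pt := ptF) rN rS).
have tansgnprj i0 j0 : \sum_k tan i0 k * (sgn k * prj k j0 * sgn j0) =
    sgn i0 * sgn j0 * (e * x / q * prj i0 j0 + q^-1).
  rewrite -tanprj mulr_sumr; apply: eq_bigr => k _.
  rewrite mulrA mulrA (tangent_sign K B F_odd (pt := ptF) rN); ring.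
(* The entry of [S C], which enters the last two idempotents through [U]. *)
have sumE i0 j0 : \sum_k tan i0 k *
    (1 * (k == j0)%:R - (prj k j0 + sgn k * prj k j0 * sgn j0)) =
    tan i0 j0 - (1 + sgn i0 * sgn j0) * (e * x / q * prj i0 j0 + q^-1).
  under eq_bigr do rewrite mul1r mulrBr mulrDr.
  rewrite sumrB big_split /= tanprj tansgnprj.
  under eq_bigr do rewrite mulrC.
  by rewrite sum_pred1; ring.
rewrite /idempotent !kmxZ !sign_mxM !mul_sign_mx !kmxD kmx_scalar !kmxB.
rewrite kmxM kmxZ kmxD kmxB !kmxZ.
case: j => [[|[|[|[|[|[|//]]]]]] ?] /=; apply: eq_kmx => i0 j0;
  rewrite /idempotent_entry /= ?mulr1 //.
- by ring.
- by ring.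
- by rewrite sumE; ring.
- by rewrite sumE; ring.
Qed.

Local Notation P := (Pmx q e n).
Local Notation Q := (Qmx q e n).
Local Notation Rel := (@quadrel F n f).
Local Notation A i := (adjmx K (Rel i)).

Lemma quadrel_index i j : Rel (Ordinal (index_lt6 i j)) i j.
Proof. by rewrite (quadrelE K F_odd). Qed.

Lemma quadrel_partition i j : exists! l, Rel l i j.
Proof.
exists (Ordinal (index_lt6 i j)); split; first exact: quadrel_index.
by move=> l; rewrite (quadrelE K F_odd) => /eqP ?; apply: val_inj.
Qed.

Lemma quadrel_sym (l : 'I_6) : symmetric (Rel l).
Proof.
move=> i j; rewrite !(quadrelE K F_odd) /rel_index /line_type.
by rewrite [j == i]eq_sym [disc (rep j) _](disc_sym kD) [sgn j * _]mulrC.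
Qed.

(** On a pair in [R_l] both sides depend only on [l], which reduces the identity to the table of
    [idempotent_entryE]. *)
Lemma idempotent_def (j : 'I_6) : E j = c0^-1 *: \sum_l Q l j *: A l.
Proof.
apply/matrixP => u v; rewrite -(enum_valK u) -(enum_valK v).
move: (enum_val u) (enum_val v) => i k {u v}.
rewrite [RHS]mxE (comb_adjmx_ent quadrel_partition _ (quadrel_index i k)).
rewrite idempotent_kmx mxE !enum_rankK.
have := projE F_odd kZ kD BDl BZl Bnd e_sqr cV sD (pt := ptF) rN rP i k.
have [-> etaE -> ->] := rel_index_values i k.
rewrite -/(line_type K i k) etaE => ->.
rewrite c0E.
exact: (idempotent_entryE n_odd n_ge3 q_ge3 erefl e_pm1 (Ordinal (index_lt6 i k))).
Qed.

Let PQ : P *m Q = c0%:M.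
Proof. by rewrite c0E (Pmx_Qmx n_odd n_ge3 q_ge3 erefl e_pm1). Qed.

Let Q_col0 (l : 'I_6) : Q l ord0 = 1.
Proof. by rewrite mxE; case: l => [[|[|[|[|[|[|//]]]]]] ?]. Qed.

Let pt_gt0 : (0 < #|{: pt}|)%N.
Proof. by move: c0_neq0; rewrite pnatr_eq0 -lt0n. Qed.

Theorem quadric_scheme : #|F| <> 3%N -> scheme_with_eigenmatrices Rel P Q.
Proof.
move=> F3; apply: (scheme_from_idempotents (E := fun j : 'I_6 => E j)) => //.
- exact: quadrel_partition.
- exact: quadrel_sym.
- move=> l; apply: (Pmx_valency n_odd n_ge3 q_ge3 erefl e_pm1) => _.
  by rewrite (eqr_nat K _ 3); apply/eqP.
- exact: idempotents_ortho.
- exact: idempotent_def.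
Qed.

Lemma quadrel2_empty : #|F| = 3%N -> forall i j, ~~ Rel (inord 2) i j.
Proof.
move=> F3 i j.
(* For [q = 3] the eigenvalue of [A_2] on the constant vector is 0, so the non-negative entries of
   each row sum to 0. *)
have := adjmx_idempotent pt_gt0 PQ idempotents_ortho idempotent_def (inord 2) ord0.
rewrite (PmxE e n_odd n_ge3 q_ge3 erefl) /= inordK //= F3 subrr mulr0 scale0r.
rewrite /idempotent /= -scalemxAr => /eqP; rewrite scaler_eq0 invr_eq0 (negPf c0_neq0) /=.
move/eqP/matrixP/(_ (enum_rank i) (enum_rank j)); rewrite !mxE => row0.
have ge0 u : true -> 0 <= A (inord 2) (enum_rank i) u * all_mx u (enum_rank j).
  by rewrite !mxE mulr1 ler0n.
have : A (inord 2) (enum_rank i) (enum_rank j) * all_mx (enum_rank j) (enum_rank j) = 0.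
  by apply: (psumr_eq0P ge0 row0).
rewrite adjmx_ent mxE mulr1 => /eqP; rewrite pnatr_eq0 eqb0 //.
Qed.

Theorem quadric_scheme3 : #|F| = 3%N ->
  scheme_with_eigenmatrices (fun l : 'I_5 => Rel (lift (inord 2) l))
    (row' (inord 4) (col' (inord 2) P)) (row' (inord 2) (col' (inord 4) Q)).
Proof.
move=> F3; have empty2 := quadrel2_empty F3.
have lift0 (h : 'I_6) : val h != 0%N -> lift h ord0 = ord0 :> 'I_6.
  by move=> h0; apply/val_inj; rewrite /= /bump leqn0 (negPf h0).
have A2 : A (inord 2) = 0.
  by apply/matrixP => u v; rewrite !mxE (negPf (empty2 _ _)).
have PE l l' : row' (inord 4) (col' (inord 2) P) l l' = P (lift (inord 4) l) (lift (inord 2) l').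
  by rewrite mxE mxE.
have QE l l' : row' (inord 2) (col' (inord 4) Q) l l' = Q (lift (inord 2) l) (lift (inord 4) l').
  by rewrite mxE mxE.
apply: (scheme_from_idempotents (E := fun j : 'I_5 => E (lift (inord 4) j))) => //.
- move=> i j; have [l [lij l_uniq]] := quadrel_partition i j.
  case: (unliftP (inord 2) l) => [l'|] lE; last by move: lij; rewrite lE (negPf (empty2 _ _)).
  exists l'; split; first by rewrite -lE.
  by move=> l2 /l_uniq; rewrite lE => /lift_inj.
- by move=> l; apply: quadrel_sym.
- by move=> i j; rewrite lift0 //= inordK.
- move=> l; rewrite PE lift0; last by rewrite /= inordK.
  apply: (Pmx_valency n_odd n_ge3 q_ge3 erefl e_pm1).
  move=> /eqP l2; case/negP: (neq_lift (inord 2) l).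
  by apply/eqP/val_inj; rewrite [LHS]inordK.
- apply/matrixP => l l'; have /matrixP /(_ (lift (inord 4) l) (lift (inord 4) l')) := PQ.
  rewrite ![_%:M _ _]mxE ![(_ *m _) _ _]mxE (bigD1_ord (inord 2)) //= (inj_eq lift_inj) => <-.
  (* For [q = 3] column 2 of [P] vanishes outside row 4: its other entries are 0 or contain the
     factor [q - 3]. *)
  rewrite (_ : P (lift (inord 4) l) (inord 2) = 0) ?mul0r ?add0r.
    by apply: eq_bigr => l2 _; rewrite PE QE.
  rewrite (PmxE e n_odd n_ge3 q_ge3 erefl) [nat_of_ord (inord 2)]inordK //.
  rewrite /= /bump inordK // F3 subrr.
  by case: l => [[|[|[|[|[|//]]]]] ?] /=; rewrite ?mulr0.
- by move=> l; rewrite QE lift0 ?Q_col0 //= inordK.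
- by move=> l l'; rewrite idempotents_ortho (inj_eq lift_inj).
- move=> l; rewrite idempotent_def (bigD1_ord (inord 2)) //= A2 scaler0 add0r.
  by congr (_ *: _); apply: eq_bigr => l2 _; rewrite QE.
Qed.

End Assembly.

Theorem theorem4p18 (K : realType) (F : finFieldType) (n : nat) (eps : int)
    (a b c : F) (q_odd : odd #|F|) (n_odd : odd n) (n_ge3 : (3 <= n)%N)
    (eps_pm1 : eps = 1 \/ eps = -1)
    (f_nondeg : bqf_nondegenerate (bqf a b c))
    (f_hyp : eps = 1 -> reducible_bipoly (bqf a b c))
    (f_ell : eps = -1 -> irreducible_bipoly (bqf a b c)) :
  let Rel := @quadrel F n (bqf a b c) in
  let P : 'M[K]_6 := Pmx #|F|%:R eps%:~R n in
  let Q : 'M[K]_6 := Qmx #|F|%:R eps%:~R n in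
  (#|F| <> 3%N -> scheme_with_eigenmatrices Rel P Q) /\
  (#|F| = 3%N ->
     (forall X Y, ~~ Rel (inord 2) X Y) /\
     scheme_with_eigenmatrices
       (fun i : 'I_5 => Rel (lift (inord 2) i))
       (row' (inord 4) (col' (inord 2) P))
       (row' (inord 2) (col' (inord 4) Q))).
Proof.
(* The sign of the quadric is the quadratic character of the discriminant of the binary form. *)
have epsE : chi K (b ^+ 2 - 4 * a * c) = eps%:~R.
  case: eps_pm1 => epsE; rewrite epsE.
    by rewrite (chi_reducible K q_odd f_nondeg (f_hyp epsE)).
  by rewrite (chi_irreducible K q_odd f_nondeg (f_ell epsE)) rmorphN1.
move=> Rel P Q; split; first exact: quadric_scheme.
by move=> F3; split; [exact: (quadrel2_empty q_odd f_nondeg n_odd n_ge3 epsE F3)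
  | exact: quadric_scheme3].
Qed.
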